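(* For all $k,s_0$ with $s_0\ge5k$, there are $C>0$ and $s_1\ge s_0$ such that the following holds. Suppose $G$ is an $n$-vertex $k$-graph and, for each $s_0\le s\le s_1$ divisible by $k$, the property $s$-graph $P=P^{(s)}(G,\mathsf{Mat}_k)$ satisfies $\delta_1(P)\ge(1-s^{-2})\binom{n-1}{s-1}$. Then $G_p$ contains a perfect matching with high probability whenever $p\ge Cn^{-k+1}\log n$ and $k$ divides $n$.
   Context: A $k$-graph ($k\ge2$ an integer) is a $k$-uniform hypergraph; $\delta_1(P)$ denotes the minimum, over all vertices of $P$, of the number of edges containing the vertex. $\mathsf{Mat}_k$ is the family of all $k$-graphs that have a perfect matching. For a $k$-graph $G$ and a family $\mathsf P$ of $k$-graphs, the property graph $P^{(s)}(G,\mathsf P)$ is the $s$-graph with vertex set $V(G)$ in which an $s$-set $S\subseteq V(G)$ is an edge if and only if $G[S]\in\mathsf P$. $G_p$ is the random subgraph of $G$ on $V(G)$ obtained by keeping each edge independently with probability $p\in[0,1]$. ''With high probability'': for every $\varepsilon>0$ and every function $p=p(n)$ as in the hypothesis there is $n_0$ such that for all $n\ge n_0$ (satisfying the divisibility condition) and every $n$-vertex $G$ satisfying the hypotheses, the event has probability at least $1-\varepsilon$. *)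

(* Defs.v *)
From HB Require Import structures.
From mathcomp Require Import all_boot all_order all_algebra.
From mathcomp Require Import reals exp.

Set Implicit Arguments.
Unset Strict Implicit.
Unset Printing Implicit Defensive.

Import Order.TTheory GRing.Theory Num.Theory.

Local Open Scope ring_scope.

Definition uniform (V : finType) (k : nat) (E : {set {set V}}) : bool :=
  [forall e in E, #|e| == k].

(* The vertex set of a k-graph is the whole type [V]. *)
Record kgraph (k : nat) (V : finType) := KGraph {
  edges : {set {set V}};
  edgesP : uniform k edges }.

HB.instance Definition _ (k : nat) (V : finType) := [isSub for @edges k V].
HB.instance Definition _ (k : nat) (V : finType) := [Finite of kgraph k V by <:].

Definition degree (k : nat) (V : finType) (G : kgraph k V) (v : V) : nat :=
  #|[set e in edges G | v \in e]|.

(* A degree is at most the number of edges, so the default value of the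
   iterated minimum is harmless as soon as there is a vertex. *)
Definition delta1 (k : nat) (V : finType) (G : kgraph k V) : nat :=
  \big[minn/#|edges G|]_(v : V) degree G v.

Lemma induced_uniform (k : nat) (V : finType) (G : kgraph k V) (S : {set V}) :
  uniform k [set e : {set {x : V | x \in S}} | val @: e \in edges G].
Proof.
apply/forall_inP => e; rewrite inE => eG.
by move/forall_inP/(_ _ eG): (edgesP G); rewrite card_imset //; exact: val_inj.
Qed.

Definition induced (k : nat) (V : finType) (G : kgraph k V) (S : {set V}) :
  kgraph k {x : V | x \in S} := KGraph (induced_uniform G S).

Definition kfamily (k : nat) := forall V : finType, pred (kgraph k V).

Definition Mat (k : nat) : kfamily k := fun V G =>
  [exists M : {set {set V}}, (M \subset edges G) && partition M [set: V]].

Lemma property_graph_uniform (s k : nat) (V : finType) (G : kgraph k V)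
    (F : kfamily k) :
  uniform s [set S : {set V} | (#|S| == s) && F _ (induced G S)].
Proof. by apply/forall_inP => S; rewrite inE => /andP[]. Qed.

Definition property_graph (s k : nat) (V : finType) (G : kgraph k V)
  (F : kfamily k) : kgraph s V := KGraph (property_graph_uniform s G F).

(* [Gp_mass G p H] is the probability that the random subgraph G_p equals H. *)
Definition Gp_mass (R : realType) (k : nat) (V : finType) (G : kgraph k V)
    (p : R) (H : kgraph k V) : R :=
  if edges H \subset edges G
  then \prod_(e in edges G) (if e \in edges H then p else 1 - p)
  else 0.

Definition Gp_prob (R : realType) (k : nat) (V : finType) (G : kgraph k V)
    (p : R) (A : pred (kgraph k V)) : R :=
  \sum_(H : kgraph k V | A H) Gp_mass G p H.

(* Main.v *)
(* A probability measure on the perfect matchings of G is spread when it gives mass at most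
   K * q ^ t to the matchings containing t prescribed edges, with q = O(n^(1-k)). The argument
   of Frankston, Kahn, Narayanan and Park then shows that a random set of edges of density
   O(q log n) contains a matching of the support: expose it in log n rounds of density 8 q,
   each of which halves, outside a set of small measure, the part of the matching that is
   still missing, until only a bounded number of edges is missing, and finish with one round
   of density q log n.

   The spread measure is obtained from a uniformly random arrangement of the vertices into N
   groups of k * L vertices, where L + 1 is a multiple of k, and a remainder of bounded size.
   The degree hypothesis makes all but a small proportion of the groups induce a graph with a
   perfect matching. A bad group is cut into L pieces of k vertices, and each piece is handed
   to its own good group, chosen at random: that group is split into k columns of size L and
   each column receives one vertex of the piece. Since every vertex lies in few bad
   (L + 1)-sets, most good groups are suitable for a given piece; a factorial moment of order
   log n makes this true for all pieces at once. Each piece has a linear number of suitable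
   helpers, hence the assignment of helpers, and with it the matching, is spread. *)
Require Import Defs.
From mathcomp Require Import all_boot all_order all_algebra.
From mathcomp Require Import reals exp.
From mathcomp Require Import sequences fingroup perm ring lra zify.

Set Implicit Arguments.
Unset Strict Implicit.
Unset Printing Implicit Defensive.

Import Order.TTheory GRing.Theory Num.Theory.

Local Open Scope ring_scope.

(** * Random subsets *)

Section RandomSubset.

Variables (R : realFieldType) (X : finType).
Implicit Types (E W : {set X}) (p : R) (F : {set X} -> R).

Definition rsubset_weight E p W : R := p ^+ #|W| * (1 - p) ^+ #|E :\: W|.

(** Probability enters only through this finite sum; events are represented by their indicator
    functions. *)
Definition rsubset_mean E p F : R :=
  \sum_(W : {set X} | W \subset E) rsubset_weight E p W * F W.

Lemma rsubset_weight_ge0 E p W : 0 <= p <= 1 -> 0 <= rsubset_weight E p W.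
Proof. by move=> /andP[p0 p1]; rewrite mulr_ge0 ?exprn_ge0 // subr_ge0. Qed.

Lemma rsubset_mean_le E p F1 F2 : 0 <= p <= 1 ->
  (forall W, W \subset E -> F1 W <= F2 W) ->
  rsubset_mean E p F1 <= rsubset_mean E p F2.
Proof.
by move=> p01 leF; apply: ler_sum => W WE; rewrite ler_wpM2l ?rsubset_weight_ge0 ?leF.
Qed.

Lemma eq_rsubset_mean E p F1 F2 : F1 =1 F2 ->
  rsubset_mean E p F1 = rsubset_mean E p F2.
Proof. by move=> eqF; apply: eq_bigr => W _; rewrite eqF. Qed.

Lemma rsubset_mean0 p F : rsubset_mean set0 p F = F set0.
Proof.
rewrite /rsubset_mean (big_pred1 set0) => [|W]; last by rewrite subset0.
by rewrite /rsubset_weight set0D !cards0 !expr0 !mul1r.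
Qed.

(** Conditioning on whether [x] is chosen. This recursion drives the inductions on [E] below. *)
Lemma rsubset_meanU1 E p F x : x \notin E ->
  rsubset_mean (x |: E) p F =
  rsubset_mean E p (fun W => p * F (x |: W) + (1 - p) * F W).
Proof.
move=> xE; rewrite /rsubset_mean (bigID (fun W : {set X} => x \in W)) /=.
under [RHS]eq_bigr => W _ do rewrite mulrDr.
rewrite big_split /=; congr (_ + _).
- rewrite (reindex_onto (fun W => x |: W) (fun W => W :\ x)) /=; last first.
    by move=> W /andP[_ xW]; rewrite setD1K.
  apply: eq_big => [W|W /andP[_ /eqP eW]].
    rewrite setU11 andbT subUset sub1set setU11 /=.
    apply/andP/idP => [[sW /eqP eW]|WE].
      apply/subsetP => y yW; have yx : y != x.
        by move: yW; rewrite -{1}eW !inE => /andP[].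
      by have /(subsetP sW) := yW; rewrite !inE (negPf yx).
    have xW : x \notin W by apply: contra xE => /(subsetP WE).
    by rewrite setU1K // eqxx (subset_trans WE) ?subsetUr.
  have xW : x \notin W by rewrite -eW !inE eqxx.
  rewrite /rsubset_weight cardsU1 xW.
  have -> : (x |: E) :\: (x |: W) = E :\: W.
    apply/setP => y; rewrite !inE; case: eqP => [->|] //=.
    by rewrite (negPf xE) andbF.
  by rewrite add1n exprS; ring.
- apply: eq_big => [W|W /andP[sW xW]].
    apply/andP/idP => [[sW xW]|WE].
      apply/subsetP => y yW; have := subsetP sW _ yW; rewrite !inE.
      by case: eqP => // eyx; rewrite -eyx yW in xW.
    by split; [rewrite (subset_trans WE) ?subsetUr | apply: contra xE => /(subsetP WE)].
  rewrite /rsubset_weight.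
  have -> : (x |: E) :\: W = x |: (E :\: W).
    by apply/setP => y; rewrite !inE; case: eqP => [->|] //=; rewrite xW.
  by rewrite cardsU1 !inE (negPf xE) andbF add1n exprS; ring.
Qed.

Lemma set_ind (P : {set X} -> Prop) : P set0 ->
  (forall E x, x \notin E -> P E -> P (x |: E)) -> forall E, P E.
Proof.
move=> P0 PS E; have [m] := ubnP #|E|; elim: m E => // m IH E.
have [->//|/set0Pn[x xE]] := eqVneq E set0.
rewrite (cardsD1 x) xE ltnS => mE; rewrite -(setD1K xE).
by apply: PS; [rewrite !inE eqxx | apply: IH].
Qed.

Lemma rsubset_mean_cst E p (a : R) : rsubset_mean E p (fun=> a) = a.
Proof.
elim/set_ind: E => [|E x xE IH]; first by rewrite rsubset_mean0.
rewrite rsubset_meanU1 // -[RHS]IH; apply: eq_rsubset_mean => W.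
by rewrite -mulrDl addrC subrK mul1r.
Qed.

Lemma rsubset_meanD E p F1 F2 : rsubset_mean E p (fun W => F1 W + F2 W) =
  rsubset_mean E p F1 + rsubset_mean E p F2.
Proof. by rewrite /rsubset_mean -big_split; apply: eq_bigr => W _; rewrite mulrDr. Qed.

Lemma rsubset_meanZ E p a F : rsubset_mean E p (fun W => a * F W) =
  a * rsubset_mean E p F.
Proof. by rewrite /rsubset_mean mulr_sumr; apply: eq_bigr => W _; rewrite mulrCA. Qed.

(** Two independent exposures amount to one: an element is missed by both with probability
    [(1 - p1) * (1 - p2)]. *)
Lemma rsubset_mean_union E p1 p2 F :
  rsubset_mean E p1 (fun W1 => rsubset_mean E p2 (fun W2 => F (W1 :|: W2))) =
  rsubset_mean E (p1 + p2 - p1 * p2) F.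
Proof.
elim/set_ind: E F => [|E x xE IH] F; first by rewrite !rsubset_mean0 setU0.
rewrite !rsubset_meanU1 // -IH; apply: eq_rsubset_mean => W1.
rewrite !rsubset_meanU1 // -!rsubset_meanZ -rsubset_meanD.
apply: eq_rsubset_mean => W2.
rewrite -!setUA [W1 :|: (x |: W2)]setUCA.
have -> : x |: (x |: (W1 :|: W2)) = x |: (W1 :|: W2) by rewrite setUA setUid.
ring.
Qed.

Lemma rsubset_mean_mono E p1 p2 F : 0 <= p1 -> p1 <= p2 -> p2 <= 1 ->
  (forall W1 W2, W1 \subset W2 -> F W1 <= F W2) ->
  rsubset_mean E p1 F <= rsubset_mean E p2 F.
Proof.
move=> p10 p12 p21; elim/set_ind: E F => [|E x xE IH] F homoF.
  by rewrite !rsubset_mean0.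
rewrite !rsubset_meanU1 //; apply: le_trans (IH _ _).
  apply: rsubset_mean_le => [|W _]; first by rewrite p10 (le_trans p12).
  (* The two sides differ by [(p2 - p1) * (F (x |: W) - F W)]. *)
  have := homoF W (x |: W) (subsetUr _ _); rewrite -subr_ge0 => F0.
  have := mulr_ge0 (_ : 0 <= p2 - p1) F0; rewrite subr_ge0 => /(_ p12) F1.
  rewrite -subr_ge0; apply: le_trans F1 _; rewrite le_eqVlt; apply/orP; left.
  by apply/eqP; ring.
move=> W1 W2 sW; apply: lerD; rewrite ler_wpM2l ?subr_ge0 ?homoF ?setUS //.
exact: le_trans p12.
Qed.

End RandomSubset.

(** * Fragments and the spread theorem *)

Section Fragments.

Variables (R : realFieldType) (X Omega : finType) (w : Omega -> R).
Hypothesis w_ge0 : forall i, 0 <= w i.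
Implicit Types (E W T Z : {set X}) (A : {set Omega}) (S : Omega -> {set X}).

Definition covered A S W := [exists i in A, S i \subset W].

(** Minimum fragment: [S i] is replaced by a member of the family inside [W :|: S i] that needs the
    fewest elements beyond [W]. For [i] in [A] the default [i] is itself admissible. *)
Definition fragment A S W i : {set X} :=
  S [arg min_(j < i | (j \in A) && (S j \subset W :|: S i)) #|S j :\: W|] :\: W.

Lemma fragmentP A S W i : i \in A ->
  exists j, [/\ j \in A, S j \subset W :|: S i, fragment A S W i = S j :\: W &
    forall j', j' \in A -> S j' \subset W :|: S i ->
      (#|fragment A S W i| <= #|S j' :\: W|)%N].
Proof.
move=> iA; rewrite /fragment; case: arg_minnP => [|j /andP[jA jS] jmin].
  by rewrite iA subsetUr.
by exists j; split => // j' j'A j'S; apply: jmin; rewrite j'A.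
Qed.

Lemma fragment_sub A S W i : i \in A -> fragment A S W i \subset S i.
Proof.
move=> /(fragmentP S W)[j [_ jS -> _]]; rewrite subDset; exact: jS.
Qed.

Lemma fragment_disjoint A S W i : fragment A S W i :&: W = set0.
Proof. by apply/setP => x; rewrite !inE; case: (x \in W); rewrite /= ?andbF. Qed.

Definition spread A S (K q : R) :=
  forall T, \sum_(i in A | T \subset S i) w i <= K * q ^+ #|T|.

(* If [T] is the fragment of [S i] relative to [W], then any member of the
   family inside [W :|: T] contains [T]; one such member is fixed by [witness]. *)
Definition witness A S Z : {set X} :=
  if [pick j in A | S j \subset Z] is Some j then S j else set0.

Lemma fragment_sub_witness A S W i : i \in A ->
  fragment A S W i \subset witness A S (W :|: fragment A S W i).
Proof.
move=> iA; have [j [jA jS eT Tmin]] := fragmentP S W iA.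
rewrite /witness; case: pickP => [j' /andP[j'A j'S]|/(_ j)]; last first.
  by rewrite jA eT -subDset subxx.
have TS := fragment_sub S W iA.
have sT : S j' :\: W \subset fragment A S W i by rewrite subDset.
have /eqP <- : S j' :\: W == fragment A S W i.
  rewrite eqEcard sT /= Tmin //; apply: subset_trans j'S _.
  by rewrite setUS.
exact: subsetDl.
Qed.

Lemma card_witness A S Z l : (forall i, i \in A -> (#|S i| <= l)%N) ->
  (#|witness A S Z| <= l)%N.
Proof.
move=> Sl; rewrite /witness; case: pickP => [j /andP[jA _]|_]; first exact: Sl.
by rewrite cards0.
Qed.

(** Double counting of pairs [(W, T)] with [T] a large fragment, through [Z = W :|: T]. Spreadness
    bounds the mass with fragment [T] by [K * q ^+ #|T|], passing from [W] to [Z] costs [p ^- #|T|],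
    and for a given [Z] the set [T] lies in a fixed set of at most [l] elements. *)
Lemma large_fragment_mean E A S (K q p : R) (l d : nat) :
  0 <= K -> 0 < q -> q <= p -> p <= 1 ->
  (forall i, i \in A -> S i \subset E) ->
  (forall i, i \in A -> (#|S i| <= l)%N) -> spread A S K q ->
  rsubset_mean E p (fun W => \sum_(i in A | (d < #|fragment A S W i|)%N) w i)
    <= K * 2 ^+ l * (q / p) ^+ d.+1.
Proof.
move=> K0 q0 qp p1 SE Sl spr.
have p0 : 0 < p by apply: lt_le_trans qp.
have p01 : 0 <= p <= 1 by rewrite ltW.
have r0 : 0 <= q / p by rewrite divr_ge0 ?ltW.
have r1 : q / p <= 1 by rewrite ler_pdivrMr ?mul1r.
pose c W T := [&& W \subset E, T \subset E, T :&: W == set0,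
  T \subset witness A S (W :|: T) & (d < #|T|)%N].
have step1 W : W \subset E ->
    rsubset_weight E p W * (\sum_(i in A | (d < #|fragment A S W i|)%N) w i) <=
    \sum_(T | c W T) rsubset_weight E p (W :|: T) * (K * (q / p) ^+ #|T|).
  move=> WE; rewrite (partition_big (fragment A S W) (c W)) /=; last first.
    move=> i /andP[iA di]; rewrite /c WE di fragment_sub_witness //.
    by rewrite fragment_disjoint eqxx (subset_trans (fragment_sub _ _ iA)) ?SE.
  rewrite mulr_sumr; apply: ler_sum => T /and5P[_ TE /eqP TW _ _].
  apply: (@le_trans _ _ (rsubset_weight E p W * (K * q ^+ #|T|))).
    rewrite ler_wpM2l ?rsubset_weight_ge0 //; apply: le_trans (spr T).
    rewrite [leRHS](bigID (fun i => (d < #|fragment A S W i|)%N &&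
      (fragment A S W i == T))) /=.
    rewrite -[leLHS]addr0; apply: lerD; last by apply: sumr_ge0.
    rewrite le_eqVlt; apply/orP; left; apply/eqP; apply: eq_bigl => i.
    rewrite -andbA; case iA: (i \in A) => //=.
    case: eqP => [<-|]; rewrite ?andbF // fragment_sub //.
  (* Adding [T] to [W] gains the factor [p ^+ #|T|] and can only remove factors [1 - p]. *)
  have Hw : rsubset_weight E p W * p ^+ #|T| <= rsubset_weight E p (W :|: T).
    rewrite /rsubset_weight cardsU setIC TW cards0 subn0 exprD mulrAC.
    rewrite ler_wpM2l ?mulr_ge0 ?exprn_ge0 ?(ltW p0) //.
    apply: ler_wiXn2l; first by rewrite subr_ge0.
      by rewrite lerBlDr lerDl ltW.
    by rewrite subset_leq_card // setDS ?subsetUl.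
  have -> : rsubset_weight E p W * (K * q ^+ #|T|) =
      rsubset_weight E p W * p ^+ #|T| * (K * (q / p) ^+ #|T|).
    rewrite expr_div_n -mulrA; congr (_ * _); rewrite mulrCA; congr (_ * _).
    by rewrite mulrC divfK // expf_neq0 // gt_eqF.
  by rewrite ler_wpM2r // mulr_ge0 // exprn_ge0.
apply: (le_trans (ler_sum _ step1)).
rewrite (exchange_big_dep (fun T => (d < #|T|)%N)) /=; last first.
  by move=> W T _ /and5P[].
have step2 T : (d < #|T|)%N ->
    \sum_(W : {set X} | (W \subset E) && c W T)
       rsubset_weight E p (W :|: T) * (K * (q / p) ^+ #|T|) <=
    \sum_(Z : {set X} | (Z \subset E) && (T \subset witness A S Z))
       rsubset_weight E p Z * (K * (q / p) ^+ d.+1).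
  move=> dT.
  have le_rd : K * (q / p) ^+ #|T| <= K * (q / p) ^+ d.+1.
    by rewrite ler_wpM2l // ler_wiXn2l.
  rewrite [leRHS](bigID (fun Z : {set X} => T \subset Z)) /= -[leLHS]addr0.
  apply: lerD; last first.
    apply: sumr_ge0 => Z _; rewrite mulr_ge0 ?rsubset_weight_ge0 //.
    by rewrite mulr_ge0 ?exprn_ge0.
  (* For fixed [T] disjoint from [W], the set [W] is recovered from [Z] as [Z :\: T]. *)
  rewrite [leRHS](reindex_onto (fun W => W :|: T) (fun Z => Z :\: T)) /=; last first.
    by move=> Z /andP[_ TZ]; rewrite setUC -[RHS](setID Z T) (setIidPr TZ).
  rewrite (eq_bigl (fun W => (((W :|: T \subset E) &&
    (T \subset witness A S (W :|: T))) && (T \subset W :|: T))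
    && ((W :|: T) :\: T == W))) => [|W].
    by apply: ler_sum => W _; rewrite ler_wpM2l ?rsubset_weight_ge0.
  rewrite /c dT subsetUr /= subUset andbT.
  have -> : (T :&: W == set0) = ((W :|: T) :\: T == W).
    rewrite setDUl setDv setU0; apply/eqP/eqP => [TW|<-].
      by apply/setDidPl; rewrite -setI_eq0 setIC TW.
    by apply/setP => x; rewrite !inE; case: (x \in T).
  by case: (W \subset E); case: (T \subset E); case: eqP; rewrite //= ?andbF ?andbT.
apply: (le_trans (ler_sum _ step2)).
rewrite (exchange_big_dep (fun Z => Z \subset E)) /=; last by move=> T Z _ /andP[].
apply: (@le_trans _ _ (\sum_(Z : {set X} | Z \subset E)
    rsubset_weight E p Z * (K * 2 ^+ l * (q / p) ^+ d.+1))); last first.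
  by rewrite [leLHS](rsubset_mean_cst E p).
apply: ler_sum => Z ZE; rewrite sumr_const.
rewrite -[leLHS]mulr_natr -[leLHS]mulrA ler_wpM2l ?rsubset_weight_ge0 //.
rewrite [leRHS]mulrAC ler_wpM2l ?mulr_ge0 ?exprn_ge0 // -natrX.
rewrite ler_nat; apply: leq_trans (leq_pexp2l _ (card_witness Z Sl)) => //.
rewrite -card_powerset; apply: subset_leq_card; apply/subsetP => T.
by rewrite !inE => /and3P[].
Qed.

(* The density of the union of [j] rounds of density [8 * q], which halve the
   fragments, followed by a round of density [p2]. *)
Fixpoint rounds (q p2 : R) (j : nat) : R :=
  if j is j'.+1 then 8 * q + rounds q p2 j' - 8 * q * rounds q p2 j' else p2.

Lemma rounds_bounds q p2 j : 0 < q -> 8 * q <= 1 -> 0 <= p2 <= 1 ->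
  0 <= rounds q p2 j <= 1 /\ rounds q p2 j <= 8 * q * j%:R + p2.
Proof.
move=> q0 q1 p2b; elim: j => [|j [/andP[IH0 IH1] IH2]] /=.
  by rewrite mulr0 add0r; split.
have m0 : 0 <= 8 * q by rewrite mulr_ge0 // ltW.
have h1 : 0 <= 8 * q * rounds q p2 j by rewrite mulr_ge0.
have h2 : 0 <= (1 - 8 * q) * (1 - rounds q p2 j) by rewrite mulr_ge0 ?subr_ge0.
have h3 : 0 <= (1 - 8 * q) * rounds q p2 j by rewrite mulr_ge0 ?subr_ge0.
rewrite -(natr1 j); split; first by apply/andP; split; lra.
lra.
Qed.

(** Induction on the number of halving rounds. After a round, indices with large fragments are given
    up, and the remaining fragments form a family of half the size that is still spread with the
    same [K] and [q], a fragment being contained in [S i]. In the base case the family is uncovered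
    only if all fragments are nonempty, which is the case [d = 0] of the previous bound. *)
Lemma spread_rounds E (K q p2 : R) (j0 j : nat) A S :
  0 <= K -> 0 < q -> 8 * q <= 1 -> q <= p2 -> p2 <= 1 ->
  (forall i, i \in A -> S i \subset E) ->
  (forall i, i \in A -> (#|S i| <= 2 ^ (j0 + j))%N) -> spread A S K q ->
  (\sum_(i in A) w i) *
    rsubset_mean E (rounds q p2 j) (fun W => (~~ covered A S W)%:R)
  <= K * (2 ^+ (2 ^ j0) * (q / p2) + \sum_(i < j) 2 ^- (2 ^ (j0 + i))).
Proof.
move=> K0 q0 q1 qp2 p21; have p20 : 0 < p2 by apply: lt_le_trans qp2.
elim: j A S => [|j IH] A S SE Sl spr /=.
  rewrite big_ord0 addr0 addn0 in Sl *.
  have H := large_fragment_mean 0 K0 q0 qp2 p21 SE Sl spr.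
  rewrite expr1 -mulrA in H; apply: le_trans H; rewrite -rsubset_meanZ; apply: rsubset_mean_le.
    by rewrite ltW.
  move=> W WE; have [|ncov] := boolP (covered A S W).
    by rewrite mulr0 sumr_ge0.
  rewrite mulr1 le_eqVlt; apply/orP; left; apply/eqP/eq_bigl => i.
  case iA: (i \in A) => //=; rewrite card_gt0; apply/esym/eqP => T0.
  have [i' [i'A _ eT _]] := fragmentP S W iA.
  move/negP: ncov; apply; apply/existsP; exists i'.
  by rewrite i'A -setD_eq0 -eT T0 eqxx.
have q8 : q <= 8 * q by lra.
set pj := rounds q p2 j.
have p2b : 0 <= p2 <= 1 by rewrite ltW.
have [/andP[pj0 pj1] _] := rounds_bounds j q0 q1 p2b; rewrite -/pj in pj0 pj1.
rewrite -(rsubset_mean_union E (8 * q) pj) -rsubset_meanZ.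
pose d := (2 ^ (j0 + j))%N.
pose bad W := \sum_(i in A | (d < #|fragment A S W i|)%N) w i.
set B := K * (2 ^+ (2 ^ j0) * (q / p2) + \sum_(i < j) 2 ^- (2 ^ (j0 + i))) in IH *.
have q80 : 0 <= 8 * q <= 1 by rewrite q1 mulr_ge0 // ltW.
apply: (@le_trans _ _ (rsubset_mean E (8 * q) (fun W => B + bad W))).
  apply: rsubset_mean_le => // W1 W1E.
  pose A' := [set i in A | (#|fragment A S W1 i| <= d)%N].
  have sA' i : i \in A' -> i \in A by rewrite inE => /andP[].
  have {}IH := IH A' (fragment A S W1) _ _ _.
  have mass : \sum_(i in A) w i = \sum_(i in A') w i + bad W1.
    rewrite (bigID (mem A')) /= /bad; congr (_ + _); apply: eq_bigl => i.
      by rewrite !inE andbA andbb.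
    by rewrite !inE; case: (i \in A); rewrite //= -ltnNge.
  apply: (@le_trans _ _ ((\sum_(i in A) w i) *
      rsubset_mean E pj (fun W => (~~ covered A' (fragment A S W1) W)%:R))).
    rewrite ler_wpM2l ?sumr_ge0 //; apply: rsubset_mean_le; first by rewrite pj0.
    move=> W2 _; rewrite ler_nat.
    case cov: (covered A' _ _); rewrite ?leq_b1 //=.
    suff -> : covered A S (W1 :|: W2) by [].
    have /existsP[i /andP[/sA' iA iW]] := cov.
    have [i' [i'A _ eT _]] := fragmentP S W1 iA.
    by apply/existsP; exists i'; rewrite i'A -subDset -eT.
  rewrite mass mulrDl; apply: lerD.
    apply: IH => [i /sA' iA|i|T].
    - exact: subset_trans (fragment_sub _ _ iA) (SE _ iA).
    - by rewrite inE => /andP[].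
    apply: le_trans (spr T).
    rewrite [leRHS](bigID (fun i => (i \in A') && (T \subset fragment A S W1 i))) /=.
    rewrite -[leLHS]addr0; apply: lerD; last by rewrite sumr_ge0.
    rewrite le_eqVlt; apply/orP; left; apply/eqP/eq_bigl => i.
    apply/idP/idP => [/andP[iA' iT]|/andP[_ //]].
    by rewrite iA' iT sA' //= andbT; apply: subset_trans iT (fragment_sub _ _ (sA' _ iA')).
  rewrite -[leRHS]mulr1 ler_wpM2l ?sumr_ge0 //.
  rewrite -[leRHS](rsubset_mean_cst E pj); apply: rsubset_mean_le.
    by rewrite pj0.
  by move=> W2 _; rewrite lern1 leq_b1.
rewrite rsubset_meanD rsubset_mean_cst big_ord_recr /= addrA mulrDr lerD2l.
apply: le_trans (large_fragment_mean d K0 q0 q8 q1 SE Sl spr) _.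
rewrite -mulrA ler_wpM2l // addnS expnS mul2n -addnn exprD -/d.
(* Here [l = 2 * d], so the loss is [K * 4 ^+ d / 8 ^+ d.+1], at most [K * 2 ^- d]. *)
have -> : q / (8 * q) = 8^-1 by rewrite invfM mulrCA divff ?mulr1 // gt_eqF.
rewrite exprS -!exprVn -exprMn mulrCA -exprMn.
have -> : (2 * 2 / 8 : R) = 2^-1 by field.
by rewrite ler_piMl ?exprn_ge0 //; lra.
Qed.

End Fragments.

(** * Counting permutations and injective choices *)

Section PermutationCounting.

Variables (I V : finType).

(** Composing with the inverse of one such permutation [s0] gives permutations that fix every
    [x i]. *)
Lemma card_perm_prescribed (x : I -> V) (f : {ffun I -> V}) : injective x ->
  (#|[set s : {perm V} | [ffun i => s (x i)] == f]| <= (#|V| - #|I|)`!)%N.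
Proof.
move=> x_inj; set D := [set s | _].
have [->|/set0Pn[s0]] := eqVneq D set0; first by rewrite cards0.
rewrite inE => /eqP s0f.
have -> : (#|V| - #|I|)%N = #|~: [set x i | i in I]|.
  by rewrite cardsCs setCK card_imset.
rewrite -card_perm -(card_imset _ (@mulIg _ (s0^-1)%g)).
apply: subset_leq_card; apply/subsetP => _ /imsetP[s /[!inE] /eqP sf ->].
apply/subsetP => v /=; apply: contraTT; rewrite !inE negbK => /imsetP[i _ ->].
have : s (x i) = s0 (x i) by move/ffunP/(_ i): sf; rewrite -s0f !ffunE.
move=> e; 
by rewrite permM e -permM mulgV perm1 eqxx.
Qed.

Lemma card_perm_in (x : I -> V) (Z : {set {ffun I -> V}}) : injective x ->
  (#|[set s : {perm V} | [ffun i => s (x i)] \in Z]|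
     <= #|Z| * (#|V| - #|I|)`!)%N.
Proof.
move=> x_inj; rewrite -sum1_card.
rewrite (partition_big (fun s : {perm V} => [ffun i => s (x i)]) (mem Z)) /=; last first.
  by move=> s; rewrite inE.
rewrite -sum_nat_const; apply: leq_sum => f fZ.
apply: leq_trans (card_perm_prescribed f x_inj); rewrite -sum1_card.
rewrite [leqRHS](bigID (fun s => s \in [set s : {perm V} | [ffun i => s (x i)] \in Z])) /=.
rewrite -[leqLHS]addn0 leq_add // eq_leq //; apply: eq_bigl => s.
by rewrite !inE andbC.
Qed.

Lemma card_inj_ffun_image (F : {set {set V}}) :
  (forall A, A \in F -> #|A| = #|I|) ->
  (#|[set y : {ffun I -> V} | injectiveb y && ([set y i | i in I] \in F)]|
    <= #|F| * (#|I|)`!)%N.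
Proof.
move=> cF; rewrite -sum1_card.
rewrite (partition_big (fun y : {ffun I -> V} => [set y i | i in I]) (mem F)) /=; last first.
  by move=> y; rewrite inE => /andP[].
rewrite -sum_nat_const; apply: leq_sum => A AF.
rewrite -ffactnn -[X in (X ^_ _)%N](cF A AF) -card_inj_ffuns_on -sum1_card.
set P := (X in (_ <= \sum_(i in X) 1)%N).
rewrite [leqRHS](bigID (fun y : {ffun I -> V} => [set y i | i in I] == A)) /=.
apply: leq_trans (leq_addr _ _); rewrite eq_leq //; apply: eq_bigl => y.
rewrite !inE; case: eqP => [eA|]; rewrite ?andbF //= !andbT eA AF andbT.
suff -> : [forall i, y i \in A] by [].
by apply/forallP => i; rewrite -eA; apply/imsetP; exists i.
Qed.

End PermutationCounting.

Lemma card_perm_image (V I : finType) (x : I -> V) (F : {set {set V}}) : injective x ->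
  (forall A, A \in F -> #|A| = #|I|) ->
  (#|[set s : {perm V} | [set s (x i) | i in I] \in F]|
     <= #|F| * ((#|I|)`! * (#|V| - #|I|)`!))%N.
Proof.
move=> x_inj cF; rewrite mulnA.
apply: leq_trans (leq_mul (card_inj_ffun_image cF) (leqnn _)).
apply: leq_trans (card_perm_in _ x_inj).
apply: subset_leq_card; apply/subsetP => s; rewrite !inE => sF.
have eA : [set [ffun i => s (x i)] i | i in I] = [set s (x i) | i in I].
  by apply: eq_imset => i; rewrite ffunE.
rewrite eA sF andbT; apply/injectiveP => i j; rewrite !ffunE.
by move/perm_inj/x_inj.
Qed.

(** * Injective choices with prescribed values *)

Section InjectiveChoice.

Variables (Q Y : finType) (Opt : Q -> {set Y}) (B : {set Q}).
Implicit Types (f : {ffun Q -> Y}) (J : {set Q * Y}).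

(** Only the values on [B] are constrained; the free values elsewhere cancel in ratios of counts. *)
Definition inj_choice f :=
  [forall q in B, f q \in Opt q] && [forall q in B, forall q' in B, (f q == f q') ==> (q == q')].

Lemma inj_choiceP f : reflect ({in B, forall q, f q \in Opt q} /\ {in B &, injective f})
  (inj_choice f).
Proof.
apply: (iffP andP) => [[/forall_inP fO /forall_inP fI]|[fO fI]]; split=> //.
- by move=> q q' qB q'B e; have /forall_inP/(_ _ q'B) := fI q qB; rewrite e eqxx => /eqP.
- exact/forall_inP.
- apply/forall_inP => q qB; apply/forall_inP => q' q'B; apply/implyP => /eqP e.
  by apply/eqP; apply: fI.
Qed.

Variable m : nat.
Hypothesis Opt_large : forall q, q \in B -> (#|B| + m <= #|Opt q|)%N.

Lemma card_new_option f q : q \in B -> (m <= #|Opt q :\: [set f q' | q' in B :\ q]|)%N.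
Proof.
move=> qB; rewrite cardsD leq_subRL; last by rewrite subset_leq_card ?subsetIl.
apply: leq_trans (Opt_large qB); rewrite leq_add2r.
apply: leq_trans (subset_leq_card (subsetIr _ _)) _.
by apply: leq_trans (leq_imset_card _ _) _; rewrite subset_leq_card ?subsetDl.
Qed.

Lemma inj_choice_update f q y : (forall q', q' \in B :\ q -> f q' \in Opt q') ->
    {in B :\ q &, injective f} -> y \in Opt q :\: [set f q' | q' in B :\ q] ->
  inj_choice [ffun q' => if q' == q then y else f q'].
Proof.
move=> fO fI; rewrite inE => /andP[yf yO]; apply/inj_choiceP; split=> [q' q'B|q1 q2 q1B q2B].
  by rewrite ffunE; case: eqP => [->//|/eqP q'q]; apply: fO; rewrite !inE q'q.
rewrite !ffunE; case: (eqVneq q1 q) => [->|n1]; case: (eqVneq q2 q) => [->|n2] //.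
- by move=> e; case/negP: yf; rewrite e; apply/imset_f; rewrite !inE n2.
- by move=> e; case/negP: yf; rewrite -e; apply/imset_f; rewrite !inE n1.
- by apply: fI; rewrite !inE ?n1 ?n2.
Qed.

Definition contains f J := [forall u in J, (u.1 \in B) && (f u.1 == u.2)].

(* Re-choosing the value at a prescribed place gives an injection from pairs
   (choice, free option) to choices with one prescription fewer. *)
Lemma card_choice_prescribed J :
  (#|[set f | inj_choice f && contains f J]| * m ^ #|J| <= #|[set f | inj_choice f]|)%N.
Proof.
have [c] := ubnP #|J|; elim: c J => // c IH J.
have [->|/set0Pn[[q y] qyJ]] := eqVneq J set0.
  by move=> _; rewrite cards0 muln1 subset_leq_card //; apply/subsetP => f; rewrite !inE => /andP[].
rewrite (cardsD1 (q, y) J) qyJ ltnS add1n => /IH; set J' := J :\ _ => {}IH.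
rewrite expnS mulnA; apply: leq_trans IH; rewrite leq_mul2r; apply/orP; right.
set L := [set f | _]; set L' := [set f | _].
have [->|/set0Pn[f1]] := eqVneq L set0; first by rewrite cards0.
rewrite inE => /andP[_ /forall_inP f1J].
have /andP[/= qB /eqP f1q] := f1J _ qyJ.
have J'q u : u \in J' -> u.1 != q.
  rewrite !inE => /andP[une uJ]; apply: contra une => /eqP uq.
  have /andP[_ /eqP f1u] := f1J _ uJ.
  by case: u uq f1u {uJ} => /= a b -> <-; rewrite f1q.
pose fresh f := Opt q :\: [set f q' | q' in B :\ q].
pose P := [set fz : {ffun Q -> Y} * Y | (fz.1 \in L) && (fz.2 \in fresh fz.1)].
have cP : (#|L| * m <= #|P|)%N.
  rewrite -[leqRHS]sum1_card (eq_bigl (fun fz => (fz.1 \in L) && (fz.2 \in fresh fz.1))); last first.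
    by move=> fz; rewrite inE.
  rewrite -(pair_big_dep (mem L) (fun f => mem (fresh f)) (fun _ _ => 1%N)) /=.
  rewrite -sum_nat_const; apply: leq_sum => f _; rewrite sum1_card; exact: card_new_option.
apply: leq_trans cP _.
pose upd (fz : {ffun Q -> Y} * Y) : {ffun Q -> Y} := [ffun q' => if q' == q then fz.2 else fz.1 q'].
have Lq f : f \in L -> f q = y.
  by rewrite inE => /andP[_ /forall_inP/(_ _ qyJ)/andP[_ /eqP]].
(* The pair is recovered from the update: the new value is read off at [q], and the old value there
   was the prescribed [y]. *)
rewrite -(card_in_imset (f := upd) (D := mem P)); last first.
  have Pq fz : fz \in P -> fz.1 q = y by rewrite inE => /andP[/Lq].
  move=> [f z] [f' z'] /Pq /= fq /Pq /= f'q /ffunP e.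
  have := e q; rewrite !ffunE eqxx => /= ->; congr (_, _); apply/ffunP => q'.
  have := e q'; rewrite !ffunE; case: eqP => [-> _|//].
  by rewrite fq f'q.
apply: subset_leq_card; apply/subsetP => _ /imsetP[[f z] + ->].
rewrite inE /= => /andP[fL zf]; move: (fL); rewrite !inE => /andP[/inj_choiceP[fO fI] /forall_inP fJ].
apply/andP; split.
  apply: inj_choice_update zf => [q'|q1 q2]; rewrite !inE => /andP[_ q1B]; first exact: fO.
  by move=> /andP[_ q2B]; apply: fI.
apply/forall_inP => u uJ'; have uJ : u \in J by move: uJ'; rewrite inE => /andP[].
by have /andP[-> fu] := fJ _ uJ; rewrite ffunE (negPf (J'q _ uJ')).
Qed.

End InjectiveChoice.

(** Greedy choice: the other elements of [B] block fewer than [#|Opt q|] options. *)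
Lemma inj_choice_exists (Q Y : finType) (Opt : Q -> {set Y}) (B : {set Q}) (y0 : Y) :
  (forall q, q \in B -> (#|B| < #|Opt q|)%N) -> exists f, inj_choice Opt B f.
Proof.
have [c] := ubnP #|B|; elim: c B => // c IH B.
have [-> _ _|/set0Pn[q qB]] := eqVneq B set0.
  by exists [ffun=> y0]; apply/inj_choiceP; split=> q; rewrite inE.
rewrite {1}(cardsD1 q) qB add1n ltnS => cB OB.
have sB : (#|B :\ q| <= #|B|)%N by rewrite subset_leq_card ?subsetDl.
have [|f /inj_choiceP[fO fI]] := IH _ cB.
  by move=> q'; rewrite inE => /andP[_ /OB]; apply: leq_ltn_trans.
have Om q' : q' \in B -> (#|B| + 1 <= #|Opt q'|)%N by rewrite addn1; apply: OB.
have /card_gt0P[y yf] := card_new_option Om f qB.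
by exists [ffun q' => if q' == q then y else f q']; apply: inj_choice_update yf.
Qed.

(** * Partitions from arrangements *)

Section Arrangement.

Variables (V : finType) (ok : pred {set V}) (N k L z : nat).

(** The slot [(g, i, l)] is row [l] of column [i] in group [g], and [inr] gives the remainder. A
    piece [(g, l)] is a row of a group, hence has one vertex in each of the [k] columns. *)
Definition slot := ('I_N * 'I_k * 'I_L + 'I_z)%type.
Definition piece := ('I_N * 'I_L)%type.

Variable c : slot -> V.
Hypothesis c_inj : injective c.
Implicit Types (s : {perm V}) (g : 'I_N) (q : piece) (f : {ffun piece -> 'I_N}).

Definition place s (p : slot) : V := s (c p).

Lemma place_inj s : injective (place s).
Proof. by move=> p p' /perm_inj/c_inj. Qed.

Definition rest_part s := [set place s (inr j) | j : 'I_z].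
Definition group_part s g := [set place s (inl (g, u.1, u.2)) | u : 'I_k * 'I_L].
Definition column_part s g i := [set place s (inl (g, i, l)) | l : 'I_L].
Definition augmented_column s q g i := place s (inl (q.1, i, q.2)) |: column_part s g i.

Definition bad_groups s := [set g | ~~ ok (group_part s g)].
Definition bad_pieces s := [set q : piece | q.1 \in bad_groups s].
(** The group of [q] is left out because its columns already contain the vertices of [q], so that
    the augmented column would not have [L.+1] elements. *)
Definition failing s q := [set g | (g != q.1) && [exists i, ~~ ok (augmented_column s q g i)]].
Definition helpers s q := [set g | (g \notin bad_groups s) && (g \notin failing s q)].

(* A bad group is dissolved: each of its pieces [q] is handed to the helper group
   [f q], which splits into its columns, the [i]-th column receiving the [i]-th
   vertex of [q]. Slots with equal labels form a part of the final partition. *)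
Definition slot_label s f (p : slot) : option ('I_N * option 'I_k) :=
  match p with
  | inr _ => None
  | inl (g, i, l) =>
    if g \in bad_groups s then Some (f (g, l), Some i)
    else if g \in [set f q | q in bad_pieces s] then Some (g, Some i)
    else Some (g, None)
  end.

Definition slot_block (p : slot) : option 'I_N :=
  if p is inl u then Some u.1.1 else None.

Section Fixed.

Variables (s : {perm V}) (f : {ffun piece -> 'I_N}).
Hypothesis rest_ok : ok (rest_part s).
Hypothesis f_choice : inj_choice (helpers s) (bad_pieces s) f.

Lemma helper_good q : q \in bad_pieces s -> f q \notin bad_groups s.
Proof.
by have /inj_choiceP[fO _] := f_choice; move=> /fO; rewrite inE => /andP[].
Qed.

(** Injectivity of [f] ensures that a helper column receives a vertex from only one piece. *)
Lemma label_column q i : q \in bad_pieces s ->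
  [set place s p | p in [set p | slot_label s f p == Some (f q, Some i)]] =
  augmented_column s q (f q) i.
Proof.
have /inj_choiceP[_ f_inj] := f_choice.
move=> qB; have qb : q.1 \in bad_groups s by rewrite inE in qB.
apply/setP => v; apply/imsetP/setU1P => [[[[[g i'] l]|j]]|[->|/imsetP[l _ ->]]].
- rewrite inE /=; case: ifP => gb.
    move=> /eqP[e ->] ->; left; have -> // : q = (g, l).
    by apply: f_inj; rewrite // inE.
  by case: ifP => _ /eqP[-> // ->] ->; right; apply: imset_f.
- by rewrite inE.
- exists (inl (q.1, i, q.2)) => //; rewrite inE /= qb.
  by case: (q).
- exists (inl (f q, i, l)) => //; rewrite inE /= (negPf (helper_good qB)).
  by rewrite imset_f.
Qed.

(** A part is the remainder, an augmented column of a helper, or an untouched good group. *)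
Lemma label_part_ok p :
  ok [set place s p' | p' in [set p' | slot_label s f p' == slot_label s f p]].
Proof.
have /inj_choiceP[fO f_inj] := f_choice.
have ok_col q i : q \in bad_pieces s -> ok (augmented_column s q (f q) i).
  move=> qB; have := fO _ qB; rewrite !inE negb_and negbK => /andP[gq].
  case/orP => [/negPn/eqP e|/existsPn/(_ i)/negPn//].
  by have := helper_good qB; rewrite e; rewrite inE in qB; rewrite qB.
case: p => [[[g i] l]|j] /=; last first.
  suff -> : [set place s p' | p' in [set p' | slot_label s f p' == None]] = rest_part s.
    by [].
  apply/setP => v; apply/imsetP/imsetP => [[[[[g i] l]|j']]|[j' _ ->]].
  - by rewrite inE /=; case: ifP => // _; case: ifP.
  - by move=> _ ->; exists j'.
  - by exists (inr j'); rewrite ?inE.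
case: ifP => gb; first by rewrite (@label_column (g, l)) ?ok_col // inE.
case: ifP => [/imsetP[q qB ->]|gu]; first by rewrite label_column ?ok_col.
suff -> : [set place s p' | p' in [set p' | slot_label s f p' == Some (g, None)]] =
  group_part s g by move/negbT: gb; rewrite inE negbK.
apply/setP => v; apply/imsetP/imsetP => [[[[[g' i'] l']|j']]|[[i' l'] _ ->]].
- rewrite inE /=; case: ifP => [_ /eqP[]//|g'b]; case: ifP => [_ /eqP[]//|_ /eqP[->] ->].
  by exists (i', l').
- by rewrite inE.
- by exists (inl (g, i', l')); rewrite // inE /= gb gu.
Qed.

(** Applied to an edge of the matching: its vertices occupy one block, or the groups of a bad piece
    and of its helper. The second case has more possibilities but also prescribes a value of [f]. *)
Lemma same_label_blocks (A : {set slot}) lab : (forall p, p \in A -> slot_label s f p = lab) ->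
  (exists b, forall p, p \in A -> slot_block p = b) \/
  (exists2 q, q \in bad_pieces s &
     forall p, p \in A -> slot_block p = Some q.1 \/ slot_block p = Some (f q)).
Proof.
have /inj_choiceP[fO f_inj] := f_choice => eA.
pose from_bad (p : slot) := if p is inl (g, _, _) then g \in bad_groups s else false.
have [/existsP[[[[g i] l]|j] /andP[pA //= gb]]|/existsPn noB] :=
    boolP [exists p in A, from_bad p].
  right; exists (g, l); first by rewrite inE.
  move=> p' p'A; have := eA _ pA; rewrite -(eA _ p'A) /= gb.
  case: p' p'A => [[[g' i'] l']|j'] p'A //=.
  case: ifP => g'b; first by case=> e _; left; have [-> _] : (g', l') = (g, l) by apply: f_inj; rewrite // inE.
  by case: ifP => // _ [<- _]; right.
left; have [->|/set0Pn[p0 p0A]] := eqVneq A set0.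
  by exists None => p; rewrite inE.
exists (slot_block p0) => p pA; have := eA _ pA; rewrite -(eA _ p0A).
have := noB p; have := noB p0; rewrite pA p0A /=.
case: p0 {p0A} => [[[g0 i0] l0]|j0]; case: p {pA} => [[[g1 i1] l1]|j1] //=.
- move=> /negPf -> /negPf ->; case: ifP => _; case: ifP => _ []; congruence.
- by move=> /negPf -> _; case: ifP.
- by move=> _ /negPf ->; case: ifP.
Qed.

End Fixed.

End Arrangement.

(** * Sets without a perfect matching *)

Lemma ffact_le_exp n m : (n ^_ m <= n ^ m)%N.
Proof. by elim: m => // m IH; rewrite ffactnSr expnSr leq_mul ?leq_subr. Qed.

Lemma exp_le_ffact n u : (2 * u ^ 2 <= n)%N -> (n ^ u <= 2 * n ^_ u)%N.
Proof.
move=> un; have [n0|n0] := posnP n; first by move: un; rewrite n0 leqn0 muln_eq0 expn_eq0 /= andbT => /eqP ->.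
(* Bernoulli's inequality [(1 - u / n) ^ j >= 1 - j * u / n] without denominators; [j = u] leaves at
   least one half. *)
have bern j : (n ^ j * (n - j * u) <= (n - u) ^ j * n)%N.
  elim: j => [|j IH]; first by rewrite mul0n subn0.
  have [le_nj|lt_jn] := leqP n (j.+1 * u); first by rewrite (eqP le_nj) muln0.
  have h : (n * (n - j.+1 * u) <= (n - j * u) * (n - u))%N.
    have [e|u0] := posnP u; first by rewrite e !muln0 !subn0.
    rewrite mulSn in lt_jn *; move: (j * u)%N lt_jn => b lt_bn.
    have [a ->] : exists a, n = (a + (u + b))%N by exists (n - (u + b))%N; lia.
    have -> : (a + (u + b) - (u + b) = a)%N by lia.
    have -> : (a + (u + b) - b = a + u)%N by lia.
    have -> : (a + (u + b) - u = a + b)%N by lia.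
    by nia.
  rewrite expnSr -mulnA; apply: leq_trans (leq_mul (leqnn _) h) _.
  rewrite mulnA; apply: leq_trans (leq_mul IH (leqnn _)) _.
  by rewrite expnSr mulnAC.
have fact_lb j : (j <= u)%N -> ((n - u) ^ j <= n ^_ j)%N.
  elim: j => // j IH ju; rewrite expnSr ffactnSr leq_mul ?IH ?leq_sub2l //; exact: ltnW.
rewrite -(leq_pmul2r n0).
apply: (@leq_trans (2 * (n ^ u * (n - u * u)))%N).
  by rewrite mulnCA leq_mul2l; apply/orP; right; lia.
rewrite -mulnA leq_mul2l /=; apply: leq_trans (bern u) _.
by rewrite leq_mul2r fact_lb ?orbT.
Qed.

Lemma exp_fact_le n u : (2 * u ^ 2 <= n)%N -> (n ^ u * (n - u)`! <= 2 * n`!)%N.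
Proof.
move=> un; have u_n : (u <= n)%N by nia.
by rewrite -(ffact_fact u_n) mulnA leq_mul2r exp_le_ffact ?orbT.
Qed.

Lemma card_pair_family (A J Y : finType) (F : A -> J -> {set Y}) :
  #|[set u : A * {ffun J -> Y} | u.2 \in family (fun j => mem (F u.1 j))]| =
  (\sum_a \prod_j #|F a j|)%N.
Proof.
rewrite -sum1_card (eq_bigl (fun u => true && (u.2 \in family (fun j => mem (F u.1 j))))).
  rewrite -(pair_big_dep xpredT (fun a => mem (family (fun j => mem (F a j)))) (fun _ _ => 1%N)) /=.
  by apply: eq_bigr => a _; rewrite sum1_card card_family foldrE big_map big_enum.
by move=> u; rewrite inE.
Qed.

Section SparseBad.

Variables (V : finType) (ok : pred {set V}).

Definition bad_sets (m : nat) := [set A : {set V} | (#|A| == m) && ~~ ok A].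

(** The degree hypothesis in complementary form: a proportion at most [m ^- 2] of the [m]-sets at
    [v] is bad. *)
Definition bad_degree_le (m : nat) := forall v,
  (m ^ 2 * #|[set A in bad_sets m | v \in A]| <= 'C(#|V|.-1, m.-1))%N.

Lemma card_bad_sets m : (0 < m)%N -> (m <= #|V|)%N -> bad_degree_le m ->
  (m ^ 2 * #|bad_sets m| <= 'C(#|V|, m))%N.
Proof.
move=> m0 mV bad_m.
have double : (\sum_v #|[set A in bad_sets m | v \in A]| = m * #|bad_sets m|)%N.
  under eq_bigr => v _ do rewrite -sum1dep_card.
  rewrite (exchange_big_dep (mem (bad_sets m))) /=; last by move=> v A _ /andP[].
  rewrite mulnC -sum_nat_const; apply: eq_bigr => A Am.
  have /eqP cA : #|A| == m by move: Am; rewrite inE => /andP[].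
  by rewrite sum1_card -[RHS]cA; apply: eq_card => v; rewrite [LHS]unfold_in /= Am.
rewrite -(leq_pmul2l m0) mulnCA -double big_distrr /=.
apply: (@leq_trans (\sum_(v : V) 'C(#|V|.-1, m.-1))%N).
  by apply: leq_sum => v _; apply: bad_m.
rewrite sum_nat_const mulnC.
case: (m) m0 => // m' _; case: #|V| => [|n'] /=; first by rewrite muln0.
by rewrite mulnC mul_bin_diag.
Qed.

Lemma card_bad_image (I : finType) (x : I -> V) : injective x -> (0 < #|I|)%N ->
  bad_degree_le #|I| ->
  (#|I| ^ 2 * #|[set s : {perm V} | ~~ ok [set s (x i) | i in I]]| <= (#|V|)`!)%N.
Proof.
move=> x_inj I0 bad_I.
have IV : (#|I| <= #|V|)%N by apply: leq_card x_inj.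
have cF A : A \in bad_sets #|I| -> #|A| = #|I| by rewrite inE => /andP[/eqP].
have := card_perm_image x_inj cF.
have -> : [set s : {perm V} | [set s (x i) | i in I] \in bad_sets #|I|] =
    [set s : {perm V} | ~~ ok [set s (x i) | i in I]].
  by apply/setP => s; rewrite !inE card_imset ?eqxx // => i j /perm_inj/x_inj.
move=> le1; apply: leq_trans (leq_mul (leqnn _) le1) _.
by rewrite mulnA -(bin_fact IV) leq_mul2r card_bad_sets ?orbT.
Qed.

Definition bad_completions (L : nat) (v : V) : {set {ffun 'I_L -> V}} :=
  [set y : {ffun 'I_L -> V} | injectiveb y && ([set y l | l : 'I_L] \in
     [set A : {set V} | (v \notin A) && (v |: A \in bad_sets L.+1) ])].

(** The comparison is with all [L]-tuples, repetitions included, so that the bounds for several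
    columns multiply. *)
Lemma card_bad_completions L v : bad_degree_le L.+1 ->
  (L.+1 ^ 2 * #|bad_completions L v| <= #|V| ^ L)%N.
Proof.
move=> bad_L; set F := [set A : {set V} | (v \notin A) && (v |: A \in bad_sets L.+1)].
have cF A : A \in F -> #|A| = #|'I_L|.
  by rewrite card_ord !inE => /and3P[vA]; rewrite cardsU1 vA add1n => /eqP[].
apply: (leq_trans (leq_mul (leqnn _) (card_inj_ffun_image cF))).
have FB : (#|F| <= #|[set A in bad_sets L.+1 | v \in A]|)%N.
  rewrite -(card_in_imset (f := fun A : {set V} => v |: A) (D := mem F)); last first.
    move=> A A' /=; rewrite !inE => /andP[vA _] /andP[vA' _] e.
    by rewrite -(setU1K vA) e setU1K.
  apply: subset_leq_card; apply/subsetP => _ /imsetP[A + ->].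
  by rewrite !inE => /andP[vA ->]; rewrite eqxx.
apply: (@leq_trans ('C(#|V|.-1, L) * L`!)%N).
  rewrite card_ord mulnA leq_mul2r; apply/orP; right.
  by apply: leq_trans (leq_mul (leqnn _) FB) _; apply: bad_L.
rewrite bin_ffact; apply: (@leq_trans (#|V|.-1 ^ L)%N); last first.
  by case: (L) => // L'; rewrite leq_exp2r ?leq_pred.
exact: ffact_le_exp.
Qed.

End SparseBad.

(** * Most arrangements are good *)

Section GoodArrangement.

Variables (V : finType) (ok : pred {set V}) (N k L z : nat) (c : slot N k L z -> V).
Hypothesis c_inj : injective c.

(** The constants leave room for helpers: bad groups and bad pieces together number at most [N / 2],
    and each piece fails with at most [N / 4] groups. *)
Definition good_arrangement (s : {perm V}) :=
  [&& ok (rest_part c s), (2 * L.+1 * #|bad_groups ok c s| <= N)%N &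
      [forall q, (4 * #|failing ok c s q| <= N)%N]].

(** Once the vertices of [q] are placed, each of the [r] columns must be a bad completion of one of
    them, which costs a factor [L.+1 ^ 2] per column. The condition on [#|V|] makes sampling without
    replacement cost only a factor 2. *)
Lemma card_all_augmented_bad (r : nat) (q : piece N L) (rho : {ffun 'I_r -> 'I_N})
    (cc : {ffun 'I_r -> 'I_k}) :
  injective rho -> (forall a, rho a != q.1) -> bad_degree_le ok L.+1 ->
  (2 * (k + r * L) ^ 2 <= #|V|)%N ->
  ((L.+1 ^ 2) ^ r *
     #|[set s | [forall a, ~~ ok (augmented_column c s q (rho a) (cc a))]]|
     <= 2 * (#|V|)`!)%N.
Proof.
move=> rho_inj rho_q bad_L large.
pose x (i : 'I_k + 'I_r * 'I_L) : V := match i with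
  | inl i => c (inl (q.1, i, q.2)) | inr u => c (inl (rho u.1, cc u.1, u.2)) end.
have x_inj : injective x.
  move=> [i|[a b]] [i'|[a' b']] /= /c_inj [].
  - by move=> ->.
  - by move=> e; case/eqP: (rho_q a').
  - by move=> e; case/eqP: (rho_q a).
  - by move=> /rho_inj -> _ ->.
pose I := ('I_k + 'I_r * 'I_L)%type.
pose tail (y : {ffun I -> V}) a : {ffun 'I_L -> V} := [ffun b => y (inr (a, b))].
pose Z := [set y : {ffun I -> V} | [forall a, tail y a \in bad_completions ok L (y (inl (cc a)))]].
have cI : #|{: I}| = (k + r * L)%N by rewrite card_sum card_prod !card_ord.
have sub : (#|[set s | [forall a, ~~ ok (augmented_column c s q (rho a) (cc a))]]| <=
    #|Z| * (#|V| - (k + r * L))`!)%N.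
  rewrite -cI; apply: leq_trans (card_perm_in Z x_inj).
  apply: subset_leq_card; apply/subsetP => s; rewrite !inE => /forallP bad_s.
  apply/forallP => a; rewrite !inE.
  set y := [ffun i => s (x i)].
  have ty b : tail y a b = place c s (inl (rho a, cc a, b)) by rewrite !ffunE.
  have yl : y (inl (cc a)) = place c s (inl (q.1, cc a, q.2)) by rewrite ffunE.
  have im : [set tail y a b | b : 'I_L] = column_part c s (rho a) (cc a).
    by apply: eq_imset => b; rewrite ty.
  have t_inj : injective (tail y a) by move=> b b'; rewrite !ty => /(place_inj c_inj)[].
  have notin : y (inl (cc a)) \notin [set tail y a b | b : 'I_L].
    apply/imsetP => -[b _]; rewrite ty yl => /(place_inj c_inj)[e _].
    by case/eqP: (rho_q a).
  rewrite notin cardsU1 notin card_imset // card_ord add1n eqxx im yl bad_s !andbT /=.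
  exact/injectiveP.
have cZ : ((L.+1 ^ 2) ^ r * #|Z| <= #|V| ^ (k + r * L))%N.
  pose split (y : {ffun I -> V}) : {ffun 'I_k -> V} * {ffun 'I_r -> {ffun 'I_L -> V}} :=
    ([ffun i => y (inl i)], [ffun a => tail y a]).
  have split_inj : injective split.
    move=> y y' [/ffunP e1 /ffunP e2]; apply/ffunP => -[i|[a b]].
      by have := e1 i; rewrite !ffunE.
    by have := e2 a; rewrite !ffunE => /ffunP/(_ b); rewrite !ffunE.
  rewrite -(card_imset _ split_inj).
  pose T := [set u : {ffun 'I_k -> V} * {ffun 'I_r -> {ffun 'I_L -> V}} |
    u.2 \in family (fun a => mem (bad_completions ok L (u.1 (cc a))))].
  have sT : (#|[set split y | y in Z]| <= #|T|)%N.
    apply: subset_leq_card; apply/subsetP => _ /imsetP[y + ->].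
    rewrite !inE => /forallP yZ; apply/forallP => a /=; rewrite !ffunE; exact: yZ.
  apply: leq_trans (leq_mul (leqnn _) sT) _.
  rewrite (card_pair_family (fun (f : {ffun 'I_k -> V}) a => bad_completions ok L (f (cc a)))).
  rewrite big_distrr /= expnD -[in leqRHS](card_ord k) -card_ffun -sum_nat_const.
  apply: leq_sum => f _.
  rewrite -[X in ((_ ^ X) * _)%N](card_ord r) -prod_nat_const -big_split /=.
  rewrite [in leqRHS]mulnC expnM -[X in (_ <= _ ^ X)%N](card_ord r) -prod_nat_const.
  by apply: leq_prod => a _; apply: card_bad_completions.
apply: leq_trans (leq_mul (leqnn _) sub) _.
rewrite mulnA; apply: leq_trans (leq_mul cZ (leqnn _)) _.
exact: exp_fact_le.
Qed.

(** Markov's inequality for the [r]-th factorial moment of the number of failing groups. The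
    probability is at most [2 * (8 * k / L.+1 ^ 2) ^ r], and [32 * k <= L.+1 ^ 2]. *)
Lemma card_many_failing (r : nat) (q : piece N L) :
  bad_degree_le ok L.+1 -> (32 * k <= L.+1 ^ 2)%N -> (0 < k)%N -> (8 * r <= N)%N ->
  (2 * (k + r * L) ^ 2 <= #|V|)%N ->
  (4 ^ r * #|[set s | (N < 4 * #|failing ok c s q|)%N]| <= 2 * (#|V|)`!)%N.
Proof.
move=> bad_L kL k0 rN large; set S := [set s | _].
have [N0|N0] := posnP N.
  have -> : S = set0.
    apply/setP => s; rewrite !inE; apply/negbTE; rewrite -leqNgt.
    by apply: leq_trans (leq_mul (leqnn 4) (max_card _)) _; rewrite card_ord; lia.
  by rewrite cards0 muln0.
pose P (rho : {ffun 'I_r -> 'I_N}) (cc : {ffun 'I_r -> 'I_k}) s :=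
  [forall a, (rho a != q.1) && ~~ ok (augmented_column c s q (rho a) (cc a))].
have moment : (N ^ r * #|S| <= 8 ^ r * \sum_(s : {perm V}) \sum_(rho : {ffun 'I_r -> 'I_N}
    | injectiveb rho) \sum_(cc : {ffun 'I_r -> 'I_k}) P rho cc s)%N.
  rewrite [leqLHS]mulnC -sum_nat_const big_distrr /=.
  rewrite [leqRHS](bigID (mem S)) /=; apply: leq_trans (leq_addr _ _).
  apply: leq_sum => s; rewrite inE => Ns.
  apply: (@leq_trans (8 ^ r * #|failing ok c s q| ^_ r)%N).
    (* As [r <= N / 8], each factor of the falling factorial stays above [N / 4 - N / 8]. *)
    have lb j : (j <= r)%N -> (N ^ j <= 8 ^ j * #|failing ok c s q| ^_ j)%N.
      elim: j => // j IH jr; rewrite ffactnSr !expnSr mulnACA leq_mul ?IH //.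
        exact: ltnW.
      by lia.
    exact: lb.
  rewrite leq_mul2l; apply/orP; right.
  rewrite -[X in (_ ^_ X)%N](card_ord r) -card_inj_ffuns_on -sum1dep_card.
  rewrite [leqRHS](bigID (fun rho : {ffun 'I_r -> 'I_N} => rho \in ffun_on (mem (failing ok c s q)))) /=.
  apply: leq_trans (leq_addr _ _).
  rewrite (eq_bigl (fun rho : {ffun 'I_r -> 'I_N} => injectiveb rho &&
    (rho \in ffun_on (mem (failing ok c s q))))); last by move=> rho; rewrite andbC.
  apply: leq_sum => rho /andP[_ /ffun_onP rhoF].
  have ex a : exists i, ~~ ok (augmented_column c s q (rho a) i).
    by have := rhoF a; rewrite inE => /andP[_ /existsP].
  pose cc := [ffun a => xchoose (ex a)].
  rewrite (bigD1 cc) //=; apply: leq_trans (leq_addr _ _).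
  rewrite lt0b; apply/forallP => a; rewrite ffunE (xchooseP (ex a)) andbT.
  by have := rhoF a; rewrite inE => /andP[].
have count (rho : {ffun 'I_r -> 'I_N}) (cc : {ffun 'I_r -> 'I_k}) : injectiveb rho ->
    ((L.+1 ^ 2) ^ r * \sum_(s : {perm V}) P rho cc s <= 2 * (#|V|)`!)%N.
  move=> /injectiveP rho_inj.
  have [/existsP[a /eqP rq]|/existsPn rq] := boolP [exists a, rho a == q.1].
    rewrite big1 ?muln0 // => s _; apply/eqP; rewrite eqb0.
    by apply/forallPn; exists a; rewrite rq eqxx.
  rewrite -big_mkcond /= sum1dep_card.
  apply: leq_trans (card_all_augmented_bad cc rho_inj rq bad_L large).
  rewrite leq_mul2l subset_leq_card ?orbT //; apply/subsetP => s; rewrite !inE.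
  by move=> /forallP h; apply/forallP => a; have /andP[] := h a.
have total : ((L.+1 ^ 2) ^ r * (N ^ r * #|S|) <= 8 ^ r * (N ^ r * (k ^ r * (2 * (#|V|)`!))))%N.
  apply: leq_trans (leq_mul (leqnn _) moment) _; rewrite mulnCA leq_mul2l; apply/orP; right.
  rewrite exchange_big big_distrr /=.
  apply: (@leq_trans (\sum_(rho : {ffun 'I_r -> 'I_N}) k ^ r * (2 * (#|V|)`!))%N); last first.
    by rewrite sum_nat_const card_ffun !card_ord.
  rewrite [leqRHS](bigID (fun rho : {ffun 'I_r -> 'I_N} => injectiveb rho)) /=.
  apply: leq_trans (leq_addr _ _); apply: leq_sum => rho rho_inj.
  have -> : (k ^ r = #|{ffun 'I_r -> 'I_k}|)%N by rewrite card_ffun !card_ord.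
  rewrite exchange_big big_distrr /= -sum_nat_const; apply: leq_sum => cc _; exact: count.
have h1 : ((8 * k * N) ^ r * (4 ^ r * #|S|) <= (8 * k * N) ^ r * (2 * (#|V|)`!))%N.
  apply: (@leq_trans ((L.+1 ^ 2) ^ r * (N ^ r * #|S|))%N).
    rewrite !mulnA -!expnMn leq_mul2r; apply/orP; right.
    case: (r) => // r'; rewrite leq_exp2r //; nia.
  by apply: leq_trans total _; rewrite !mulnA -!expnMn (mulnAC 8).
by move: h1; rewrite leq_pmul2l // expn_gt0 !muln_gt0 k0 N0.
Qed.

(** Each of the three conditions fails with probability at most 1/4: the remainder since
    [z ^ 2 >= 4], the number of bad groups by Markov's inequality, the failing groups by a union
    bound over at most [#|V|] pieces. *)
Lemma card_good_arrangement (r : nat) :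
  bad_degree_le ok L.+1 -> bad_degree_le ok (k * L) -> bad_degree_le ok z ->
  (1 < k)%N -> (1 < z)%N -> (32 * k <= L.+1 ^ 2)%N -> (3 < L)%N -> (8 * r <= N)%N ->
  (0 < N)%N -> (2 * (k + r * L) ^ 2 <= #|V|)%N -> (8 * #|V| <= 4 ^ r)%N ->
  ((#|V|)`! <= 4 * #|[set s | good_arrangement s]|)%N.
Proof.
move=> bad_L bad_kL bad_z k1 z1 kL L3 rN N0 large rV.
have k0 : (0 < k)%N by lia.
pose E1 := [set s | ~~ ok (rest_part c s)].
pose E2 := [set s | (N < 2 * L.+1 * #|bad_groups ok c s|)%N].
pose E3 := [set s | [exists q, (N < 4 * #|failing ok c s q|)%N]].
have inE1 : (4 * #|E1| <= (#|V|)`!)%N.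
  have x_inj : injective (fun j : 'I_z => c (inr j)) by move=> j j' /c_inj[].
  have := @card_bad_image _ ok _ _ x_inj; rewrite card_ord => /(_ _ bad_z).
  move=> h; apply: leq_trans (h _); last by lia.
  by apply: leq_mul => //; nia.
have inE2 : (4 * #|E2| <= (#|V|)`!)%N.
  have grp g : ((k * L) ^ 2 * #|[set s | ~~ ok (group_part c s g)]| <= (#|V|)`!)%N.
    have x_inj : injective (fun u : 'I_k * 'I_L => c (inl (g, u.1, u.2))).
      by move=> [i l] [i' l'] /c_inj[-> ->].
    have := @card_bad_image _ ok _ _ x_inj; rewrite card_prod !card_ord; apply=> //; nia.
  have markov : ((k * L) ^ 2 * (N * #|E2|) <= 2 * L.+1 * (N * (#|V|)`!))%N.
    apply: (@leq_trans ((k * L) ^ 2 * (2 * L.+1 * \sum_(s : {perm V}) #|bad_groups ok c s|))%N).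
      rewrite leq_mul2l; apply/orP; right.
      rewrite mulnC -sum_nat_const big_distrr /= [leqRHS](bigID (mem E2)) /=.
      by apply: leq_trans (leq_addr _ _); apply: leq_sum => s; rewrite inE => /ltnW.
    rewrite mulnCA leq_mul2l /=; under eq_bigr => s _ do rewrite -sum1dep_card big_mkcond.
    rewrite exchange_big big_distrr /= -[X in (_ <= X * _)%N](card_ord N) -sum_nat_const.
    by apply: leq_sum => g _; rewrite -big_mkcond /= sum1dep_card; apply: grp.
  have h : (8 * L.+1 * (N * #|E2|) <= (k * L) ^ 2 * (N * #|E2|))%N.
    by rewrite leq_mul2r; apply/orP; right; nia.
  have := leq_trans h markov; rewrite !(mulnCA _ N) leq_pmul2l //; nia.
have inE3 : (4 * #|E3| <= (#|V|)`!)%N.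
  have NL : (#|{: piece N L}| <= #|V|)%N.
    have x_inj : injective (fun q : piece N L => c (inl (q.1, Ordinal k0, q.2))).
      by move=> [g l] [g' l'] /c_inj[-> ->].
    exact: leq_card x_inj.
  have uni : (#|E3| <= \sum_q #|[set s | (N < 4 * #|failing ok c s q|)%N]|)%N.
    rewrite -sum1_card; under [leqRHS]eq_bigr => q _ do rewrite -sum1dep_card big_mkcond.
    rewrite exchange_big [leqRHS](bigID (mem E3)) /=; apply: leq_trans (leq_addr _ _).
    apply: leq_sum => s; rewrite inE => /existsP[q Nq].
    by rewrite (bigD1 q) //= Nq.
  have V0 : (0 < #|V|)%N by apply/card_gt0P; exists (c (inl (Ordinal N0, Ordinal k0, Ordinal (ltnW (ltnW (ltnW L3)))))).
  rewrite -(leq_pmul2l (_ : 0 < 2 * #|V|)%N) ?muln_gt0 //.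
  rewrite mulnA -[(2 * _ * 4)%N]/(2 * #|V| * 4)%N.
  have -> : (2 * #|V| * 4 = 8 * #|V|)%N by lia.
  apply: leq_trans (leq_mul rV uni) _; rewrite big_distrr /=.
  apply: (@leq_trans (\sum_(q : piece N L) 2 * (#|V|)`!)%N).
    by apply: leq_sum => q _; apply: card_many_failing.
  by rewrite sum_nat_const mulnC mulnAC leq_mul2r leq_mul2l NL !orbT.
have cov : [set: {perm V}] \subset [set s | good_arrangement s] :|: (E1 :|: (E2 :|: E3)).
  apply/subsetP => s _; rewrite !inE /good_arrangement.
  case: (ok _) => //=; case: leqP => //= _; rewrite -implyNb; apply/implyP => /forallPn[q].
  by rewrite -ltnNge => h; apply/existsP; exists q.
have cU := leq_trans (subset_leq_card cov) (leq_trans (leq_card_setU _ _)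
  (leq_add (leqnn _) (leq_trans (leq_card_setU _ _) (leq_add (leqnn _) (leq_card_setU _ _))))).
have cT : #|[set: {perm V}]| = (#|V|)`!.
  rewrite -cardsT -card_perm; apply: eq_card => s; rewrite inE unfold_in.
  by apply/esym/subsetP => v _; rewrite inE.
rewrite cT in cU; move: cU inE1 inE2 inE3.
by move: #|E1| #|E2| #|E3| #|[set s | _]| (#|V|)`! => e1 e2 e3 g a; lia.
Qed.

End GoodArrangement.

(** * Weights of choices *)

Section ChoiceWeight.

Variables (R : realFieldType) (Y1 Y2 : finType) (theta : R).
Hypothesis theta_ge0 : 0 <= theta.

(** Entries in [Y2] will be pairs of a bad piece and its helper; a pair shared by several edges is
    prescribed only once. *)
Definition used (t : nat) (a : t.-tuple (Y1 + Y2)) := [set u | inr u \in a].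

Lemma card_used t (a : t.-tuple (Y1 + Y2)) : (#|used a| <= t)%N.
Proof.
have inr_inj : injective (@inr Y1 Y2) by move=> u v [].
rewrite -(card_imset _ inr_inj) -[leqRHS](size_tuple a); apply: leq_trans (card_size a).
by apply: subset_leq_card; apply/subsetP => _ /imsetP[u + ->]; rewrite inE.
Qed.

(* Repeated choices of the same element of [Y2] cost only once, so the next entry
   contributes at most 1 for each element of [Y1] or already used element of [Y2]. *)
Lemma sum_choice_weight (C : R) t : #|Y1|%:R + t%:R + #|Y2|%:R * theta <= C ->
  \sum_(a : t.-tuple (Y1 + Y2)) theta ^+ #|used a| <= C ^+ t.
Proof.
elim: t => [|t IH] leC.
  rewrite (big_pred1 [tuple]) => [|a]; last by apply/esym/eqP; rewrite tuple0.
  have -> : used [tuple] = set0 by apply/setP => u; rewrite !inE.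
  by rewrite cards0.
have {}IH : \sum_(a : t.-tuple (Y1 + Y2)) theta ^+ #|used a| <= C ^+ t.
  apply: IH; apply: le_trans leC; rewrite lerD2r lerD2l ler_nat; exact: leqnSn.
have Y10 : 0 <= #|Y1|%:R :> R by rewrite ler0n.
rewrite (reindex (fun xa : (Y1 + Y2) * t.-tuple (Y1 + Y2) => [tuple of xa.1 :: xa.2])) /=; last first.
  exists (fun a : t.+1.-tuple _ => (thead a, [tuple of behead a])) => [[x a] _|a _] /=.
    by rewrite theadE; congr (_, _); apply: val_inj.
  by rewrite -tuple_eta.
rewrite -(pair_bigA _ (fun x (a : t.-tuple (Y1 + Y2)) => theta ^+ #|used [tuple of x :: a]|)) /=.
rewrite exchange_big exprSr /=.
apply: (@le_trans _ _ (\sum_(a : t.-tuple (Y1 + Y2)) theta ^+ #|used a| * C)); last first.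
  rewrite -mulr_suml ler_wpM2r //; apply: le_trans leC.
  by rewrite !addr_ge0 // mulr_ge0.
apply: ler_sum => a _; rewrite big_sumType /=.
have e1 y1 : used [tuple of inl y1 :: a] = used a by apply/setP => u; rewrite !inE.
have e2 y2 : used [tuple of inr y2 :: a] = y2 |: used a.
  by apply/setP => u; rewrite !inE.
under eq_bigr => y1 _ do rewrite e1.
under [X in _ + X]eq_bigr => y2 _ do rewrite e2.
rewrite sumr_const (bigID (mem (used a))) /=.
rewrite (eq_bigr (fun=> theta ^+ #|used a|)) => [|y2 y2a]; last first.
  by rewrite (setUidPr _) // sub1set.
rewrite [X in _ + (_ + X)](eq_bigr (fun=> theta ^+ #|used a| * theta)) => [|y2 y2a]; last first.
  by rewrite cardsU1 (negbTE y2a) add1n exprSr.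
rewrite !sumr_const -!(mulr_natr (_ ^+ _)) -(mulr_natr (_ * _)) -mulrA -!mulrDr.
rewrite ler_wpM2l ?exprn_ge0 //; apply: le_trans leC; rewrite -addrA lerD2l.
apply: lerD; first by rewrite ler_nat; apply: leqW; apply: card_used.
by rewrite mulrC ler_wpM2r // ler_nat max_card.
Qed.

End ChoiceWeight.

(** Induction lowering both [n] and [u]; each step costs [(1 + 1 / m) ^ v], at most [expR 1] since
    [v <= m]. *)
Lemma exp_fact_le_expR (R : realType) n u : (u <= n)%N ->
  n%:R ^+ u * (n - u)`!%:R <= expR 1 ^+ u * n`!%:R :> R.
Proof.
elim: n u => [|m IH] [|v] //; rewrite ?subn0 ?expr0 //.
rewrite ltnS => vm; rewrite subSS.
have [m0|m0] := posnP m.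
  move: vm; rewrite m0 leqn0 => /eqP ->; rewrite !expr1 !mulr1.
  by have := expR_ge1Dx (1 : R); lra.
have mR : 0 < m%:R :> R by rewrite ltr0n.
have base : m.+1%:R = m%:R * (1 + m%:R^-1) :> R.
  by rewrite mulrDr mulr1 divff ?natr1 // gt_eqF.
have pow : (1 + m%:R^-1) ^+ v <= expR 1 :> R.
  have h1 : (1 : R) <= 1 + m%:R^-1 by rewrite lerDl invr_ge0 ltW.
  apply: (@le_trans _ _ ((1 + m%:R^-1) ^+ m)); first by rewrite ler_weXn2l.
  apply: (@le_trans _ _ (expR m%:R^-1 ^+ m)).
    by rewrite lerXn2r ?nnegrE ?expR_ge0 ?expR_ge1Dx // (le_trans ler01).
  by rewrite -expRM_natl mulr_natl -[_ *+ m]mulr_natr mulVf ?gt_eqF.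
have -> : m.+1%:R ^+ v.+1 * (m - v)`!%:R =
    m.+1%:R * ((1 + m%:R^-1) ^+ v * (m%:R ^+ v * (m - v)`!%:R)) :> R.
  by rewrite exprS {2}base exprMn; ring.
have -> : expR 1 ^+ v.+1 * m.+1`!%:R = m.+1%:R * (expR 1 * (expR 1 ^+ v * m`!%:R)) :> R.
  by rewrite factS natrM exprS; ring.
rewrite ler_wpM2l // ler_pM ?mulr_ge0 ?exprn_ge0 ?addr_ge0 ?invr_ge0 //.
exact: IH.
Qed.

(** * The spread measure on perfect matchings *)

Section Matchable.

Variables (k : nat) (V : finType) (G : kgraph k V).

(** A perfect matching of the graph induced on [A], with edges kept as subsets of [V] instead of a
    subtype. *)
Definition matchable (A : {set V}) :=
  [exists M : {set {set V}}, (M \subset edges G) && partition M A].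

Lemma Mat_induced_matchable (A : {set V}) : Mat (induced G A) -> matchable A.
Proof.
move=> /existsP[M /andP[ME Mp]]; apply/existsP.
have v_inj : injective (val : {x : V | x \in A} -> V) by apply: val_inj.
exists [set val @: (e : {set {x : V | x \in A}}) | e in M]; apply/andP; split.
  apply/subsetP => _ /imsetP[e eM ->].
  by have := subsetP ME _ eM; rewrite inE.
have eA : val @: [set: {x : V | x \in A}] = A.
  apply/esym; apply/setP => v; apply/idP/imsetP => [vA|[[x xA] _ ->] //].
  by exists (Sub v vA); rewrite ?inE ?SubK.
by rewrite -[X in partition _ X]eA imset_partition.
Qed.

Lemma card_edge e : e \in edges G -> #|e| = k.
Proof. by move/(forall_inP (edgesP G))/eqP. Qed.

Section Labelled.

Variables (Lab : eqType) (lab : V -> Lab).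

Definition label_compatible (M : {set {set V}}) :=
  [&& M \subset edges G, partition M [set: V] &
      [forall e in M, forall u in e, forall v in e, lab u == lab v]].

Lemma label_compatible_exists :
  (forall v, matchable [set u | lab u == lab v]) -> exists M, label_compatible M.
Proof.
move=> ok_part; pose part v := [set u | lab u == lab v].
have part_eq u v : u \in part v -> part u = part v.
  by rewrite inE => /eqP e; apply/setP => x; rewrite !inE e.
have part_self v : v \in part v by rewrite inE.
(* The matching depends only on the class as a set, so vertices with equal labels share it. *)
pose m (A : {set V}) : {set {set V}} :=
  odflt set0 [pick M : {set {set V}} | (M \subset edges G) && partition M A].
have mP v : m (part v) \subset edges G /\ partition (m (part v)) (part v).
  rewrite /m; case: pickP => [M /andP[]|noM] //.
  by have /existsP[M] := ok_part v; rewrite noM.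
have m_sub v e : e \in m (part v) -> e \subset part v.
  by have [_ pm] := mP v; exact: partitionS.
exists (\bigcup_v m (part v)); apply/and3P; split.
- by apply/bigcupsP => v _; have [] := mP v.
- apply/and3P; split.
  + apply/eqP/setP => v; rewrite !inE; have [_ /cover_partition cm] := mP v.
    have : v \in cover (m (part v)) by rewrite cm.
    by case/bigcupP => e em ve; apply/bigcupP; exists e => //; apply/bigcupP; exists v.
  + apply/trivIsetP => e e' /bigcupP[v _ em] /bigcupP[v' _ e'm'] ee'.
    apply/pred0P => u /=; apply/negbTE/negP => /andP[ue ue'].
    have euv := part_eq _ _ (subsetP (m_sub _ _ em) _ ue).
    have euv' := part_eq _ _ (subsetP (m_sub _ _ e'm') _ ue').
    have [_ /partition_trivIset/trivIsetP tm] := mP u.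
    have := tm e e'; rewrite {1}euv {1}euv' em e'm' ee' => /(_ isT isT isT)/pred0P/(_ u) /=.
    by rewrite ue ue'.
  + apply/bigcupP => -[v _ /= m0]; have [_ /partition0] := mP v.
    by rewrite m0.
- apply/forall_inP => e /bigcupP[v _ em].
  apply/forall_inP => u ue; apply/forall_inP => u' u'e.
  by have := subsetP (m_sub _ _ em) _ ue; have := subsetP (m_sub _ _ em) _ u'e;
    rewrite !inE => /eqP -> /eqP ->.
Qed.

End Labelled.

Lemma card_perfect_matching (M : {set {set V}}) :
  M \subset edges G -> partition M [set: V] -> (#|V| = #|M| * k)%N.
Proof.
move=> ME /card_uniform_partition <-; first by rewrite cardsT.
by move=> e /(subsetP ME)/card_edge.
Qed.

End Matchable.

(** Lists the vertices of disjoint edges injectively, as the counts of permutations require. *)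
Lemma disjoint_sets_enum (V : finType) (k : nat) (v0 : V) (T : {set {set V}}) :
  trivIset T -> (forall e, e \in T -> #|e| = k) ->
  exists y : 'I_#|T| * 'I_k -> V, injective y /\
    forall j i, y (j, i) \in (enum_val j : {set V}).
Proof.
move=> /trivIsetP tT cT.
pose y (u : 'I_#|T| * 'I_k) := nth v0 (enum (enum_val u.1 : {set V})) u.2.
have szT (j : 'I_#|T|) : size (enum (enum_val j : {set V})) = k.
  by rewrite -cardE cT // enum_valP.
have yj j i : y (j, i) \in (enum_val j : {set V}).
  by rewrite -mem_enum mem_nth // szT /=.
exists y; split=> // -[j i] [j' i'] e.
have ej : j = j'.
  apply: enum_val_inj; apply/eqP; apply: contraT => ne.
  have := tT _ _ (enum_valP j) (enum_valP j') ne.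
  by move=> /pred0P/(_ (y (j, i))) /=; rewrite yj e yj.
move: e; rewrite -ej /y /= => /eqP; rewrite nth_uniq ?szT ?enum_uniq //.
by move/eqP/val_inj ->.
Qed.

(** * The law of the random matching and its spreadness *)

Section SpreadMatching.

Variables (R : realType) (k : nat) (V : finType) (G : kgraph k V) (N L z : nat).
Variables (c : slot N k L z -> V) (c' : V -> slot N k L z).
Hypotheses (cK : cancel c c') (c'K : cancel c' c).
Hypotheses (k_gt0 : (0 < k)%N) (L_gt0 : (0 < L)%N) (N_gt0 : (0 < N)%N).

Local Notation ok := (matchable G).
Local Notation Omega := ({perm V} * {ffun piece N L -> 'I_N})%type.

Let c_inj : injective c := can_inj cK.

Definition valid_choice (s : {perm V}) (f : {ffun piece N L -> 'I_N}) :=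
  inj_choice (helpers ok c s) (bad_pieces ok c s) f.

Definition outcomes : {set Omega} :=
  [set o | good_arrangement ok c o.1 && valid_choice o.1 o.2].

(** A uniform good arrangement, followed by a uniform valid assignment of helpers for it. *)
Definition outcome_weight (o : Omega) : R :=
  #|[set s | good_arrangement ok c s]|%:R^-1 * #|[set f | valid_choice o.1 f]|%:R^-1.

Definition position (s : {perm V}) (v : V) : slot N k L z := c' (s^-1%g v).

Definition vertex_label (o : Omega) (v : V) :=
  slot_label ok c o.1 o.2 (position o.1 v).

(** The default [set0] does not occur on [outcomes], by [outcome_matchingP]. *)
Definition outcome_matching (o : Omega) : {set {set V}} :=
  odflt set0 [pick M | label_compatible G (vertex_label o) M].

Lemma outcome_weight_ge0 o : 0 <= outcome_weight o.
Proof. by rewrite mulr_ge0 ?invr_ge0 ?ler0n. Qed.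

Lemma place_position s v : place c s (position s v) = v.
Proof. by rewrite /place /position c'K permKV. Qed.

Lemma position_place s p : position s (place c s p) = p.
Proof. by rewrite /place /position permK cK. Qed.

Lemma outcome_matchingP o : o \in outcomes ->
  label_compatible G (vertex_label o) (outcome_matching o).
Proof.
rewrite inE => /andP[/and3P[rest_ok _ _] f_choice]; rewrite /outcome_matching.
have [|M0 M0P] := @label_compatible_exists k V G _ (vertex_label o).
  move=> v; have := label_part_ok rest_ok f_choice (position o.1 v).
  congr (ok _); apply/setP => u; apply/imsetP/idP => [[p + ->]|].
    by rewrite !inE /vertex_label position_place.
  by rewrite inE => uv; exists (position o.1 u); rewrite ?inE // place_position.
by case: pickP => [M|/(_ M0)]; rewrite ?M0P.
Qed.

Lemma good_helpers s q : good_arrangement ok c s ->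
  q \in bad_pieces ok c s ->
  (#|bad_pieces ok c s| + (N + 3) %/ 4 <= #|helpers ok c s q|)%N.
Proof.
move=> /and3P[_ few_bad /forallP/(_ q) few_fail] _.
have cB : (#|bad_pieces ok c s| <= #|bad_groups ok c s| * L)%N.
  have cL : #|[set: 'I_L]| = L by rewrite cardsT card_ord.
  rewrite -[X in (_ <= _ * X)%N]cL -cardsX; apply: subset_leq_card; apply/subsetP => u.
  by rewrite !inE andbT.
have cH : (N <= #|helpers ok c s q| + (#|bad_groups ok c s| + #|failing ok c s q|))%N.
  have cN : #|[set: 'I_N]| = N by rewrite cardsT card_ord.
  rewrite -[X in (X <= _)%N]cN.
  have cov : [set: 'I_N] \subset helpers ok c s q :|: (bad_groups ok c s :|: failing ok c s q).
    apply/subsetP => g _; rewrite in_setU in_setU inE.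
    by case: (g \in bad_groups ok c s); case: (g \in failing ok c s q).
  apply: leq_trans (subset_leq_card cov) (leq_trans (leq_card_setU _ _) _).
  by rewrite leq_add2l leq_card_setU.
move: cB cH few_bad few_fail; move: #|bad_pieces _ _ _| #|helpers _ _ _ _|
  #|bad_groups _ _ _| #|failing _ _ _ _| => a h b d ab; nia.
Qed.

(** Bounds the probability cost of one prescribed helper, since [(N + 3) %/ 4] options remain
    free. *)
Definition choice_ratio : R := 4 / N%:R.

Lemma choice_ratio_ge0 : 0 <= choice_ratio.
Proof. by rewrite divr_ge0. Qed.

Lemma valid_choice_exists s : good_arrangement ok c s -> exists f, valid_choice s f.
Proof.
move=> gs; apply: (inj_choice_exists (Ordinal N_gt0)) => q qB.
by apply: leq_trans (good_helpers gs qB); lia.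
Qed.

Lemma card_valid_prescribed s J : good_arrangement ok c s ->
  #|[set f | valid_choice s f && contains (bad_pieces ok c s) f J]|%:R *
    #|[set f | valid_choice s f]|%:R^-1 <= choice_ratio ^+ #|J| :> R.
Proof.
move=> gs; have [f0 f0P] := valid_choice_exists gs.
have c0 : (0 < #|[set f | valid_choice s f]|)%N by apply/card_gt0P; exists f0; rewrite inE.
rewrite ler_pdivrMr ?ltr0n // mulrC -ler_pdivrMr ?exprn_gt0 ?divr_gt0 ?ltr0n //.
have /card_choice_prescribed/(_ J) := @good_helpers s ^~ gs.
rewrite -(ler_nat R) natrM natrX; apply: le_trans.
rewrite ler_wpM2l // -exprVn lerXn2r ?nnegrE ?invr_ge0 ?choice_ratio_ge0 ?ler0n //.
rewrite /choice_ratio invf_div ler_pdivrMr // -natrM ler_nat; lia.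
Qed.

Lemma sum_outcome_weight : (0 < #|[set s | good_arrangement ok c s]|)%N ->
  \sum_(o in outcomes) outcome_weight o = 1.
Proof.
move=> good0; rewrite (eq_bigl (fun o : Omega => good_arrangement ok c o.1 &&
  valid_choice o.1 o.2)) => [|o]; last by rewrite inE.
rewrite -(pair_big_dep (good_arrangement ok c) valid_choice (fun s f => outcome_weight (s, f))) /=.
rewrite (eq_bigr (fun=> #|[set s | good_arrangement ok c s]|%:R^-1)) => [|s gs].
  rewrite sumr_const cardsE -[LHS]mulr_natr mulVf // pnatr_eq0 -lt0n.
  by rewrite -cardsE.
have [f0 f0P] := valid_choice_exists gs.
rewrite /outcome_weight /= -mulr_sumr sumr_const -cardsE -[X in _ * X]mulr_natr.
rewrite mulVf ?mulr1 // pnatr_eq0 -lt0n; apply/card_gt0P; exists f0; rewrite inE //.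
Qed.

(** The two cases of [same_label_blocks]. The size of a region is bounded in terms of [k], [L] and
    [z] only. *)
Definition region (a : option 'I_N + piece N L * 'I_N) : {set slot N k L z} :=
  match a with
  | inl b => [set p | slot_block p == b]
  | inr (q, g) => [set p | slot_block p == Some q.1] :|: [set p | slot_block p == Some g]
  end.

Lemma card_region a : (#|region a| <= 2 * (k * L + z))%N.
Proof.
have card_block b : (#|[set p : slot N k L z | slot_block p == b]| <= k * L + z)%N.
  case: b => [g|].
    have sub : [set p : slot N k L z | slot_block p == Some g] \subset
        [set inl (g, u.1, u.2) | u : 'I_k * 'I_L].
      apply/subsetP => -[[[g' i] l]|j]; rewrite inE //= => /eqP[->].
      by apply/imsetP; exists (i, l).
    apply: leq_trans (subset_leq_card sub) _; apply: leq_trans (leq_imset_card _ _) _.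
    by rewrite card_prod !card_ord leq_addr.
  have sub : [set p : slot N k L z | slot_block p == None] \subset [set inr j | j : 'I_z].
    by apply/subsetP => -[[[g' i] l]|j]; rewrite inE // => _; apply/imsetP; exists j.
  apply: leq_trans (subset_leq_card sub) _; apply: leq_trans (leq_imset_card _ _) _.
  by rewrite card_ord leq_addl.
case: a => [b|[q g]] /=; first by apply: leq_trans (card_block b) _; lia.
apply: leq_trans (leq_card_setU _ _) _.
by apply: leq_trans (leq_add (card_block _) (card_block _)) _; lia.
Qed.

Section FixedEdges.

Variables (t : nat) (y : 'I_t * 'I_k -> V).
Hypothesis y_inj : injective y.

Definition fits (s : {perm V}) (a : t.-tuple (option 'I_N + piece N L * 'I_N)) :=
  [forall u, position s (y u) \in region (tnth a u.1)].

Lemma card_fits a :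
  (#|[set s | fits s a]| <= (2 * (k * L + z)) ^ (t * k) * (#|V| - t * k)`!)%N.
Proof.
pose Z := [set x : {ffun 'I_t * 'I_k -> V} |
  x \in family (fun u => mem [set v | c' v \in region (tnth a u.1)])].
have cI : #|{: 'I_t * 'I_k}| = (t * k)%N by rewrite card_prod !card_ord.
have cZ : (#|Z| <= (2 * (k * L + z)) ^ (t * k))%N.
  rewrite cardsE card_family foldrE big_map big_enum /= -cI -prod_nat_const.
  apply: leq_prod => u _; apply: leq_trans (card_region (tnth a u.1)).
  rewrite -(card_imset _ (can_inj c'K)); apply: subset_leq_card; apply/subsetP.
  by move=> _ /imsetP[v + ->]; rewrite inE.
apply: leq_trans (leq_mul cZ (leqnn _)); rewrite -cI.
apply: leq_trans (card_perm_in Z y_inj).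
(* Positions of given vertices are values of the inverse permutation. *)
rewrite -(card_imset _ (@invg_inj _)); apply: subset_leq_card.
apply/subsetP => _ /imsetP[s + ->]; rewrite !inE => /forallP fit.
by apply/forallP => u; rewrite ffunE inE; apply: fit.
Qed.

Lemma matching_fits o (e : 'I_t -> {set V}) : o \in outcomes ->
  (forall j, e j \in outcome_matching o) -> (forall j i, y (j, i) \in e j) ->
  exists a, fits o.1 a && contains (bad_pieces ok c o.1) o.2 (used a).
Proof.
move=> oO eM ye; have /and3P[_ _ /forall_inP compat] := outcome_matchingP oO.
have /andP[/and3P[rest_ok _ _] f_choice] : good_arrangement ok c o.1 && valid_choice o.1 o.2.
  by rewrite inE in oO.
have ex j : exists b : option 'I_N + piece N L * 'I_N,
    [forall i, position o.1 (y (j, i)) \in region b] &&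
    (if b is inr (q, g) then (q \in bad_pieces ok c o.1) && (o.2 q == g) else true).
  pose A := [set position o.1 v | v in e j].
  have yA i : position o.1 (y (j, i)) \in A by apply: imset_f.
  have i0 : 'I_k := Ordinal k_gt0.
  have eA p : p \in A -> slot_label ok c o.1 o.2 p = vertex_label o (y (j, i0)).
    case/imsetP => v ve ->; have /forall_inP/(_ _ ve)/forall_inP := compat _ (eM j).
    by move/(_ _ (ye j i0))/eqP.
  have [[b bA]|[q qB qA]] := same_label_blocks f_choice eA.
    exists (inl b); rewrite andbT; apply/forallP => i.
    by rewrite inE bA.
  exists (inr (q, o.2 q)); rewrite /= qB eqxx !andbT; apply/forallP => i.
  by rewrite !inE; have [->|->] := qA _ (yA i); rewrite eqxx ?orbT.
exists [tuple xchoose (ex j) | j < t]; apply/andP; split.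
  apply/forallP => -[j i]; rewrite tnth_mktuple /=.
  by have /andP[/forallP/(_ i)] := xchooseP (ex j).
apply/forall_inP => -[q g]; rewrite inE => /tnthP[j]; rewrite tnth_mktuple => e1.
by have /andP[_] := xchooseP (ex j); rewrite -e1.
Qed.

End FixedEdges.

Hypothesis good_large : ((#|V|)`! <= 4 * #|[set s | good_arrangement ok c s]|)%N.

(** Per edge: total weight [6 * #|V|] of the regions, times the chance that [k] given vertices land
    in one, with [expR 1] per vertex for sampling without replacement. *)
Definition spread_ratio : R :=
  6 * (2 * (k * L + z)%:R * expR 1) ^+ k * #|V|%:R ^- k.-1.

Lemma card_slots : #|V| = (N * k * L + z)%N.
Proof.
have := bij_eq_card (Bijective cK c'K).
by rewrite card_sum !card_prod !card_ord.
Qed.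

(** Union bound over the tuples of regions that the edges of [T] may occupy. The constant 4 pays for
    conditioning on a good arrangement. *)
Lemma spread_outcome_matching : (1 < k)%N ->
  spread outcome_weight outcomes outcome_matching 4 spread_ratio.
Proof.
move=> k_gt1 T; have rhs0 : 0 <= 4 * spread_ratio ^+ #|T|.
  by rewrite mulr_ge0 ?exprn_ge0 // /spread_ratio !mulr_ge0 ?invr_ge0 ?exprn_ge0 ?mulr_ge0 ?expR_ge0.
(* Either no outcome contains [T] and the sum is empty, or [T] consists of disjoint [k]-sets. *)
have [noT|/set0Pn[o0]] := eqVneq [set o in outcomes | T \subset outcome_matching o] set0.
  rewrite big_pred0 // => o; apply/negbTE.
  by have := in_set0 o; rewrite -noT inE => ->.
rewrite inE => /andP[o0O To0].
have /and3P[ME0 pM0 _] := outcome_matchingP o0O.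
have tT : trivIset T by apply: trivIsetS To0 (partition_trivIset pM0).
have cT e : e \in T -> #|e| = k by move/(subsetP To0)/(subsetP ME0)/card_edge.
pose v0 : V := c (inl (Ordinal N_gt0, Ordinal k_gt0, Ordinal L_gt0)).
have [y [y_inj ye]] := disjoint_sets_enum v0 tT cT.
set t := #|T| in y y_inj ye *.
have tkV : (t * k <= #|V|)%N.
  have := leq_card y y_inj; by rewrite card_prod !card_ord.
have := good_large; set g := #|[set s | good_arrangement ok c s]| => g_large.
have g0 : (0 < g)%N by have := fact_gt0 #|V|; lia.
have n0 : (0 < #|V|)%N by rewrite card_slots; nia.
have bound_a a : \sum_(o in outcomes | fits y o.1 a && contains (bad_pieces ok c o.1) o.2 (used a))
    outcome_weight o <=
    choice_ratio ^+ #|used a| * (g%:R^-1 * ((2 * (k * L + z)) ^ (t * k) * (#|V| - t * k)`!)%:R).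
  rewrite (eq_bigl (fun o : Omega => (good_arrangement ok c o.1 && fits y o.1 a) &&
    (valid_choice o.1 o.2 && contains (bad_pieces ok c o.1) o.2 (used a)))); last first.
    by move=> o; rewrite inE andbACA.
  rewrite -(pair_big_dep (fun s => good_arrangement ok c s && fits y s a)
    (fun s f => valid_choice s f && contains (bad_pieces ok c s) f (used a))
    (fun s f => outcome_weight (s, f))) /=.
  apply: (@le_trans _ _ (\sum_(s | good_arrangement ok c s && fits y s a)
      g%:R^-1 * choice_ratio ^+ #|used a|)).
    apply: ler_sum => s /andP[gs _]; rewrite /outcome_weight /= sumr_const -cardsE.
    rewrite -[leLHS]mulr_natr -[leLHS]mulrA ler_wpM2l ?invr_ge0 // mulrC.
    exact: card_valid_prescribed.
  rewrite sumr_const -[leLHS]mulr_natr [leRHS]mulrCA -[leLHS]mulrA.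
  rewrite ler_wpM2l ?invr_ge0 // ler_wpM2l ?exprn_ge0 ?choice_ratio_ge0 // ler_nat.
  apply: leq_trans (card_fits y_inj a); rewrite cardsE.
  by apply: subset_leq_card; apply/subsetP => s; rewrite !unfold_in => /andP[].
apply: (@le_trans _ _ (\sum_(a : t.-tuple (option 'I_N + piece N L * 'I_N))
    \sum_(o in outcomes | fits y o.1 a && contains (bad_pieces ok c o.1) o.2 (used a))
      outcome_weight o)).
  rewrite (exchange_big_dep (mem outcomes)) /=; last by move=> a o _ /andP[].
  rewrite [leRHS](bigID (fun o => T \subset outcome_matching o)) /= -[leLHS]addr0.
  apply: lerD; last by rewrite sumr_ge0 // => o _; rewrite sumr_ge0 // => a _; exact: outcome_weight_ge0.
  apply: ler_sum => o /andP[oO To].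
  have [a aP] := matching_fits (e := fun j => enum_val j) oO (fun j => subsetP To _ (enum_valP j)) ye.
  rewrite (bigD1 a) /=; last by rewrite oO.
  by rewrite lerDl sumr_ge0 // => a' _; exact: outcome_weight_ge0.
apply: le_trans (ler_sum _ (fun a _ => bound_a a)) _; rewrite -mulr_suml.
(* Per entry there are [N.+1] blocks, at most [t] repetitions, and [N * L * N] pairs of weight
   [4 / N]. *)
have sum_le : \sum_(a : t.-tuple (option 'I_N + piece N L * 'I_N)) choice_ratio ^+ #|used a|
    <= (6 * #|V|%:R) ^+ t.
  apply: (@sum_choice_weight R _ _ choice_ratio choice_ratio_ge0 (6 * #|V|%:R) t).
  rewrite card_option !card_prod !card_ord /choice_ratio.
  have -> : (N * L * N)%:R * (4 / N%:R) = (4 * (N * L))%:R :> R.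
    rewrite !natrM; field; first by rewrite pnatr_eq0 -lt0n.
  rewrite -!natrD -natrM ler_nat card_slots.
  have : (t <= N * k * L + z)%N by rewrite -card_slots; nia.
  by nia.
apply: le_trans (ler_wpM2r _ sum_le) _; first by rewrite mulr_ge0 ?invr_ge0.
have g_inv : g%:R^-1 <= 4 / (#|V|)`!%:R :> R.
  rewrite ler_pdivlMr ?ltr0n ?fact_gt0 // mulrC ler_pdivrMr ?ltr0n //.
  by rewrite -natrM ler_nat.
have fact_le : (#|V| - t * k)`!%:R <= expR 1 ^+ (t * k) * (#|V|)`!%:R / #|V|%:R ^+ (t * k) :> R.
  by rewrite ler_pdivlMr ?exprn_gt0 ?ltr0n // mulrC exp_fact_le_expR.
apply: (@le_trans _ _ ((6 * #|V|%:R) ^+ t * (4 / (#|V|)`!%:R * ((2 * (k * L + z)%:R) ^+ (t * k) *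
    (expR 1 ^+ (t * k) * (#|V|)`!%:R / #|V|%:R ^+ (t * k)))))).
  rewrite ler_wpM2l ?exprn_ge0 ?mulr_ge0 // ler_pM ?invr_ge0 ?ler0n // natrM natrX natrM.
  by rewrite ler_wpM2l // exprn_ge0 // mulr_ge0.
rewrite le_eqVlt; apply/orP; left; apply/eqP.
have f0 : (#|V|)`!%:R != 0 :> R by rewrite pnatr_eq0 -lt0n fact_gt0.
have n0R : #|V|%:R != 0 :> R by rewrite pnatr_eq0 -lt0n.
rewrite /spread_ratio -/t.
have -> : #|V|%:R ^- k.-1 = #|V|%:R / #|V|%:R ^+ k :> R.
  rewrite -{2}(prednK k_gt0) exprS; field; by rewrite expf_neq0.
rewrite !(mulnC t) !exprM !exprMn exprVn -!exprM !(mulnC k t).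
have nt0 : #|V|%:R ^+ (t * k) != 0 :> R by rewrite expf_neq0.
move: (#|V|`!%:R : R) f0 (#|V|%:R ^+ (t * k) : R) nt0 => f f0 M M0.
move: (2 ^+ (t * k) : R) ((k * L + z)%:R ^+ (t * k) : R) (expR 1 ^+ (t * k) : R).
move: (6 ^+ t : R) (#|V|%:R ^+ t : R) => x1 x2 x3 x4 x5.
by field; rewrite M0 f0.
Qed.

End SpreadMatching.

(** * The random subgraph *)

Lemma card_sets_containing (V : finType) (v : V) s :
  (#|[set A : {set V} | (#|A| == s.+1) && (v \in A)]| <= 'C(#|V|.-1, s))%N.
Proof.
have <- : #|[set~ v]| = #|V|.-1 by rewrite cardsC1.
rewrite -cards_draws -(card_in_imset (f := fun A : {set V} => A :\ v)
  (D := mem [set A : {set V} | (#|A| == s.+1) && (v \in A)])); last first.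
  by move=> A A' /=; rewrite !inE => /andP[_ vA] /andP[_ vA'] e; rewrite -(setD1K vA) e setD1K.
apply: subset_leq_card; apply/subsetP => _ /imsetP[A + ->]; rewrite !inE => /andP[/eqP cA vA].
by move: cA; rewrite (cardsD1 v) vA add1n => -[->]; rewrite eqxx andbT subsetDr.
Qed.

Lemma delta1_le_degree k (V : finType) (P : kgraph k V) v : (delta1 P <= degree P v)%N.
Proof.
rewrite /delta1; have := mem_index_enum v; elim: (index_enum V) => // u s IH.
rewrite big_cons inE => /predU1P[<-|/IH]; first exact: geq_minl.
exact/leq_trans/geq_minr.
Qed.

(** At [v], bad [s]-sets and edges of the property graph are disjoint families of [s]-sets
    containing [v]. *)
Lemma property_graph_bad_degree (R : realType) k (V : finType) (G : kgraph k V) s : (0 < s)%N ->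
  (1 - s%:R ^- 2) * 'C(#|V|.-1, s.-1)%:R
    <= (delta1 (property_graph s G (@Mat k)))%:R :> R ->
  bad_degree_le (matchable G) s.
Proof.
case: s => // s _ le_delta v /=; set P := property_graph _ _ _ in le_delta.
have sum_le : (#|[set A in bad_sets (matchable G) s.+1 | v \in A]| + degree P v <=
    'C(#|V|.-1, s))%N.
  apply: leq_trans (card_sets_containing v s).
  rewrite /degree -cardsUI [X in (_ + X)%N](_ : _ = 0)%N ?addn0; last first.
    apply: eq_card0 => A; rewrite !inE; apply/negP.
    case/andP=> /andP[/andP[_ /negP nA] _] /andP[/andP[_ /Mat_induced_matchable//]].
  apply: subset_leq_card; apply/subsetP => A; rewrite !inE.
  by case/orP=> /andP[/andP[-> _] ->].
have s2 : 0 < s.+1%:R ^+ 2 :> R by rewrite exprn_gt0 ?ltr0n.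
rewrite -(ler_nat R) natrM natrX -ler_pdivlMl //.
have := le_trans le_delta (_ : _ <= (degree P v)%:R :> R); rewrite ler_nat.
move=> /(_ (delta1_le_degree _ _)); move: sum_le; rewrite -(ler_nat R) natrD /=.
rewrite mulrBl mul1r lerBlDl => h1 /(le_trans h1).
by rewrite lerD2r.
Qed.

Section RandomSubgraph.

Variables (R : realType) (k : nat) (V : finType) (G : kgraph k V).
Implicit Types (p : R).

Definition has_perfect_matching (W : {set {set V}}) :=
  [exists M : {set {set V}}, (M \subset W) && partition M [set: V]].

Lemma Gp_mass_weight p (H : kgraph k V) : edges H \subset edges G ->
  Gp_mass G p H = rsubset_weight (edges G) p (edges H).
Proof.
move=> HG; rewrite /Gp_mass HG /rsubset_weight (bigID (mem (edges H))) /=.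
congr (_ * _).
  rewrite (eq_bigr (fun=> p)) => [|e /andP[_ ->]] //; rewrite prodr_const.
  congr (_ ^+ _); apply: eq_card => e; rewrite unfold_in /=.
  by apply/andP/idP => [[]|eH] //; rewrite (subsetP HG).
rewrite (eq_bigr (fun=> 1 - p)) => [|e /andP[_ /negbTE ->]] //; rewrite prodr_const.
by congr (_ ^+ _); apply: eq_card => e; rewrite unfold_in /= inE andbC.
Qed.

Lemma Gp_prob_Mat p :
  Gp_prob G p (@Mat k V) =
  rsubset_mean (edges G) p (fun W => (has_perfect_matching W)%:R).
Proof.
rewrite /Gp_prob (bigID (fun H : kgraph k V => edges H \subset edges G)) /=.
rewrite [X in _ + X]big1 ?addr0 => [|H /andP[_ /negbTE nH]]; last by rewrite /Gp_mass nH.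
pose D := [set H : kgraph k V | Mat H && (edges H \subset edges G)].
rewrite (eq_bigl (mem D)) => [|H]; last by rewrite !inE.
rewrite (eq_bigr (fun H => rsubset_weight (edges G) p (val H))) => [|H]; last first.
  by rewrite !inE => /andP[_ HG]; apply: Gp_mass_weight.
rewrite -(big_imset (fun W => rsubset_weight (edges G) p W)) /=; last first.
  by move=> H H' _ _; apply: val_inj.
rewrite /rsubset_mean [RHS](bigID has_perfect_matching) /=.
rewrite [X in _ = _ + X]big1 ?addr0 => [|W /andP[_ /negbTE ->]]; last by rewrite mulr0.
apply: eq_big => [W|W]; last first.
  case/imsetP => H; rewrite inE => /andP[HM HG] ->.
  by rewrite [has_perfect_matching _]HM mulr1.
apply/imsetP/andP => [[H + ->]|[WG WM]]; first by rewrite inE => /andP[HM HG].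
have Wu : uniform k W.
  by apply/forall_inP => e eW; have /forall_inP := edgesP G; apply; apply: (subsetP WG).
by exists (KGraph Wu) => //; rewrite inE WG andbT.
Qed.

End RandomSubgraph.

Lemma sum_half_tower (R : realFieldType) (j0 j : nat) :
  \sum_(i < j) 2 ^- (2 ^ (j0 + i)) <= 2 ^- j0 :> R.
Proof.
have h0 m : 0 <= 2 ^- m :> R by rewrite invr_ge0 exprn_ge0.
apply: (@le_trans _ _ (2 ^- j0 - 2 ^- (j0 + j))); last by rewrite gerBl h0.
elim: j => [|j IH]; first by rewrite big_ord0 addn0 subrr.
have H : 2 ^- (2 ^ (j0 + j)) <= 2 ^- (j0 + j).+1 :> R.
  rewrite lef_pV2 ?posrE ?exprn_gt0 // ler_weXn2l ?ler1n //.
  exact: ltn_expl.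
have e : 2 ^- (j0 + j) = 2 * 2 ^- (j0 + j).+1 :> R.
  by rewrite exprS invfM mulrA divff ?mul1r // pnatr_eq0.
rewrite big_ord_recr /=; apply: le_trans (lerD IH H) _.
by rewrite addnS e; lra.
Qed.

(** The bound for a fixed [n]: [j] halving rounds reduce the missing part to at most [2 ^ j0] edges,
    and a round of density [lambda * q] supplies them. The factor 4 is the spread constant. *)
Lemma Gp_prob_Mat_lower_bound (R : realType) k (V : finType) (G : kgraph k V)
    (N L z r j0 j : nat) (q lambda p : R) :
  #|V| = (N * k * L + z)%N -> (1 < k)%N -> (3 < L)%N -> (1 < z)%N -> (0 < N)%N ->
  bad_degree_le (matchable G) L.+1 -> bad_degree_le (matchable G) (k * L) ->
  bad_degree_le (matchable G) z ->
  (32 * k <= L.+1 ^ 2)%N -> (8 * r <= N)%N ->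
  (2 * (k + r * L) ^ 2 <= #|V|)%N -> (8 * #|V| <= 4 ^ r)%N ->
  (#|V| <= 2 ^ (j0 + j))%N ->
  6 * (2 * (k * L + z)%:R * expR 1) ^+ k * #|V|%:R ^- k.-1 <= q ->
  0 < q -> 8 * q <= 1 -> 1 <= lambda ->
  8 * q * j%:R + lambda * q <= p -> p <= 1 ->
  1 - 4 * (2 ^+ (2 ^ j0) / lambda + 2 ^- j0) <= Gp_prob G p (@Mat k V).
Proof.
move=> cV k1 L3 z1 N0 bad_L bad_kL bad_z kL rN large rV Vj qV q0 q1 l1 pj p1.
have l0 : 0 < lambda by lra.
have cS : #|{: slot N k L z}| = #|V| by rewrite card_sum !card_prod !card_ord.
pose c (u : slot N k L z) : V := enum_val (cast_ord cS (enum_rank u)).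
pose c' (v : V) : slot N k L z := enum_val (cast_ord (esym cS) (enum_rank v)).
have cK : cancel c c' by move=> u; rewrite /c /c' enum_valK cast_ordK enum_rankK.
have c'K : cancel c' c by move=> u; rewrite /c /c' enum_valK cast_ordKV enum_rankK.
have k0 : (0 < k)%N by lia.
have L0 : (0 < L)%N by lia.
have good := card_good_arrangement (can_inj cK) bad_L bad_kL bad_z k1 z1 kL L3 rN N0 large rV.
have good0 : (0 < #|[set s | good_arrangement (matchable G) c s]|)%N.
  by have := fact_gt0 #|V|; lia.
have spr := spread_outcome_matching R cK c'K k0 L0 N0 good k1.
have mass := sum_outcome_weight R k0 L0 N0 good0.
set O := outcomes G c in spr mass.
set S := outcome_matching G c c' in spr.
have SP o : o \in O -> S o \subset edges G /\ partition (S o) [set: V].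
  by move=> /(outcome_matchingP cK c'K) /and3P[].
have sprq : spread (outcome_weight R G c) O S 4 q.
  move=> T; apply: le_trans (spr T) _; rewrite ler_wpM2l //.
  apply: lerXn2r => //; rewrite nnegrE ?(ltW q0) //.
  by rewrite /spread_ratio !mulr_ge0 ?invr_ge0 ?exprn_ge0 ?mulr_ge0 ?expR_ge0.
have q_le : q <= lambda * q by rewrite ler_peMl // ltW.
have p2_le : lambda * q <= 1.
  by apply: le_trans p1; apply: le_trans pj; rewrite lerDr !mulr_ge0 ?ler0n // ltW.
have p2b : 0 <= lambda * q <= 1 by rewrite p2_le andbT mulr_ge0 // ltW.
have [/andP[pr0 pr1] pr_le] := rounds_bounds j q0 q1 p2b.
have := spread_rounds (E := edges G) (j0 := j0) (j := j) (@outcome_weight_ge0 R _ _ G N L z c)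
  (ler0n R 4) q0 q1 q_le p2_le _ _ sprq.
rewrite mass mul1r => fail.
have {}fail : rsubset_mean (edges G) (rounds q (lambda * q) j) (fun W => (~~ covered O S W)%:R) <=
    4 * (2 ^+ (2 ^ j0) / lambda + 2 ^- j0).
  apply: le_trans (fail _ _) _ => [o /SP[]//|o /SP[ME Mp]|].
    by apply: leq_trans Vj; rewrite (card_perfect_matching ME Mp) leq_pmulr.
  rewrite ler_wpM2l // lerD ?sum_half_tower //.
  by rewrite invfM (mulrCA q) divff ?mulr1 // gt_eqF.
rewrite Gp_prob_Mat.
apply: (@le_trans _ _ (rsubset_mean (edges G) (rounds q (lambda * q) j)
    (fun W => (covered O S W)%:R))).
  have total : rsubset_mean (edges G) (rounds q (lambda * q) j)
      (fun W => (covered O S W)%:R + (~~ covered O S W)%:R) = 1 :> R.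
    rewrite -[RHS](rsubset_mean_cst (edges G) (rounds q (lambda * q) j)).
    by apply: eq_rsubset_mean => W; case: (covered O S W); rewrite ?addr0 ?add0r.
  by rewrite rsubset_meanD in total; lra.
apply: (@le_trans _ _ (rsubset_mean (edges G) p (fun W => (covered O S W)%:R))).
  apply: rsubset_mean_mono => // [|W1 W2 W12]; first exact: le_trans pr_le pj.
  rewrite ler_nat; case cov: (covered O S W1) => //.
  have /existsP[o /andP[oO oW]] := cov.
  by rewrite (_ : covered O S W2) //; apply/existsP; exists o; rewrite oO (subset_trans oW).
apply: rsubset_mean_le => [|W _].
  by rewrite p1 andbT; apply: le_trans pr0 (le_trans pr_le pj).
rewrite ler_nat; case cov: (covered O S W) => //.
have /existsP[o /andP[oO oW]] := cov.
rewrite (_ : has_perfect_matching W) //; apply/existsP; exists (S o).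
by rewrite oW; have [_ ->] := SP _ oO.
Qed.

(** * Numerical parameters and conclusion *)

Lemma sqr_le_exp2 (A : nat) : exists t0, forall t, (t0 <= t)%N -> (A * t.+1 ^ 2 <= 2 ^ t)%N.
Proof.
exists (3 * A + 10)%N => t; elim: t => [|t IH]; first by rewrite addnC.
rewrite leq_eqVlt => /predU1P[<-|].
  have h B : ((3 * B + 11) ^ 2 <= 2 ^ (2 * B + 10))%N.
    elim: B => // B IHB; have -> : (2 * B.+1 + 10 = 2 + (2 * B + 10))%N by lia.
    by rewrite expnD; apply: leq_trans (leq_mul (leqnn (2 ^ 2)) IHB); nia.
  have -> : (3 * A + 10 = A + (2 * A + 10))%N by lia.
  rewrite expnD leq_mul //; first exact: ltnW (ltn_expl _ _).
  by apply: leq_trans (h A); nia.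
rewrite ltnS => tA; rewrite [leqRHS]expnS; apply: leq_trans (leq_mul (leqnn 2) (IH tA)).
by rewrite mulnCA leq_mul2l; apply/orP; right; nia.
Qed.

Lemma trunc_log_le_ln (R : realType) n : (0 < n)%N ->
  (trunc_log 2 n)%:R * ln 2 <= ln n%:R :> R.
Proof.
move=> n0; rewrite mulr_natl -lnXn ?ltr0n // -natrX.
by rewrite ler_ln ?posrE ?ltr0n ?expn_gt0 // ler_nat trunc_logP.
Qed.

(** Setting [L.+1] vertices aside before dividing keeps the remainder [z] at least [L.+1], hence in
    the range of the degree hypothesis. Here [u] is of order [log n]. *)
Lemma block_parameters k L u n : (0 < k)%N -> (0 < L)%N -> (7 < n)%N -> (0 < u)%N ->
  ((2 * (k + L) ^ 2 + 9 * (k * L) + L.+1) * u ^ 2 <= n)%N -> (n < 2 ^ u)%N ->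
  let N := ((n - L.+1) %/ (k * L))%N in let z := (L.+1 + (n - L.+1) %% (k * L))%N in
  [/\ n = (N * k * L + z)%N, (8 * u <= N)%N, (2 * (k + u * L) ^ 2 <= n)%N &
      (8 * n <= 4 ^ u)%N].
Proof.
move=> k0 L0 n7 u0 large n_u N z.
have kL0 : (0 < k * L)%N by rewrite muln_gt0 k0.
have uu : (u <= u ^ 2)%N by rewrite -{1}(expn1 u) leq_pexp2l.
have n_ge : (L.+1 + 8 * u * (k * L) <= n)%N.
  apply: leq_trans large; move: uu u0; clear.
  by move: (u ^ 2)%N ((k + L) ^ 2)%N (k * L)%N (L.+1)%N => U X Y Z uU u0; nia.
split.
- by rewrite /z addnCA -mulnA -divn_eq subnKC // (leq_trans (leq_addr _ _) n_ge).
- by rewrite leq_divRL // leq_subRL ?(leq_trans (leq_addr _ _) n_ge).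
- apply: leq_trans large; apply: (@leq_trans (2 * (k + L) ^ 2 * u ^ 2)%N).
    rewrite -mulnA leq_mul2l /= -expnMn leq_exp2r // mulnDl [(L * u)%N]mulnC.
    by rewrite leq_add2r leq_pmulr.
  by rewrite leq_mul2r -addnA leq_addr orbT.
- apply: (@leq_trans (2 ^ u * 2 ^ u)%N).
    by rewrite leq_mul ?(ltnW n_u) //; apply: leq_trans n7 (ltnW n_u).
  by rewrite -expnD addnn -mul2n expnM.
Qed.

(* The lower bound on [p n] is only required for large [n]: for small [n] its
   right-hand side may exceed 1, so no [p] could satisfy it for every [n]. *)
Theorem theorem3p2 (R : realType) (k s0 : nat)
    (hk : (2 <= k)%N) (hs0 : (5 * k <= s0)%N) :
  exists (C : R) (s1 : nat), 0 < C /\ (s0 <= s1)%N /\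
    forall (eps : R) (p : nat -> R),
      0 < eps ->
      (forall n : nat, 0 <= p n <= 1) ->
      (exists m : nat, forall n : nat, (m <= n)%N -> (k %| n)%N ->
         C * n%:R ^- k.-1 * ln n%:R <= p n) ->
      exists n0 : nat, forall n : nat, (n0 <= n)%N -> (k %| n)%N ->
        forall (V : finType) (G : kgraph k V),
          #|V| = n ->
          (forall s : nat, (s0 <= s <= s1)%N -> (k %| s)%N ->
             (1 - s%:R ^- 2) * 'C(n.-1, s.-1)%:R
               <= (delta1 (property_graph s G (@Mat k)))%:R :> R) ->
          1 - eps <= Gp_prob G (p n) (@Mat k V).
Proof.
(* Makes [L.+1] and [k * L] multiples of [k] that are at least [s0]; [s1] exceeds both and every
   remainder. *)
pose L := (k * s0).-1; pose s1 := (k * s0 + k * L)%N.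
have LE : L.+1 = (k * s0)%N by rewrite prednK // muln_gt0; lia.
have ks_ge : (20 <= k * s0)%N by nia.
have L_ge : (19 <= L)%N by rewrite -ltnS LE.
have L0 : (0 < L)%N by apply: leq_trans L_ge.
have k0 : (0 < k)%N by apply: ltnW.
have kL_s0 : (s0 <= k * L)%N by nia.
(* The constant of [spread_ratio], with [z] replaced by its bound [s1] to be independent of [n]. *)
pose D : R := 6 * (2 * (k * L + s1)%:R * expR 1) ^+ k.
have D0 : 0 < D.
  rewrite mulr_gt0 // exprn_gt0 // !mulr_gt0 ?expR_gt0 // ltr0n; nia.
have ln2 : 0 < ln 2 :> R by rewrite ln_gt0 // ltr1n.
(* The first summand pays for at most [u] halving rounds of density [8 * q], the last one for the
   final round. *)
pose a : R := 8 * ((ln 2)^-1 + 1) + 1.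
have iln2 : 0 < (ln 2 : R)^-1 by rewrite invr_gt0.
have a9 : 9 < a by rewrite /a; lra.
exists (D * a), s1; split; first by rewrite mulr_gt0 //; lra.
split; first by rewrite /s1; nia.
move=> eps p eps0 p01 [m pm].
(* The two error terms are kept below [eps / 8] each, one by [j0] and the other by [lam <= ln n]. *)
have [j0 j0P] : exists j0, 8 / eps <= 2 ^+ j0 :> R.
  exists (Num.truncn (8 / eps)).+1; apply: ltW.
  apply: (@lt_le_trans _ _ (Num.truncn (8 / eps)).+1%:R).
    by rewrite real_truncnS_gt // num_real.
  by rewrite -natrX ler_nat ltnW // ltn_expl.
pose lam : R := 1 + 8 * 2 ^+ (2 ^ j0) / eps.
have [t0 t0P] := sqr_le_exp2 (2 * (k + L) ^ 2 + 9 * (k * L) + L.+1).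
exists (maxn m (maxn (maxn 8 (2 ^ j0)) (maxn (2 ^ t0) (Num.truncn (expR lam)).+1))) => n.
rewrite !geq_max => /and3P[mn /andP[n8 jn] /andP[tn en]] kn V G cV hG.
have n0 : (0 < n)%N by apply: leq_trans n8.
(* Serves as the order of the factorial moment and, as [u - j0], as the number of halving rounds. *)
set u := (trunc_log 2 n).+1.
have large : ((2 * (k + L) ^ 2 + 9 * (k * L) + L.+1) * u ^ 2 <= n)%N.
  by apply: leq_trans (trunc_logP (isT : 1 < 2)%N n0); apply: t0P; rewrite trunc_log_max.
have n_u : (n < 2 ^ u)%N by rewrite trunc_log_ltn.
have j0u : (j0 <= u)%N by apply: leqW; rewrite trunc_log_max.
have [] := block_parameters k0 L0 n8 (ltn0Sn _ : (0 < u)%N) large n_u.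
set N := (_ %/ _)%N; set z := (_ + _ %% _)%N => nE uN large' nu4.
have N0 : (0 < N)%N by apply: leq_trans uN.
have z_ge : (k * s0 <= z)%N by rewrite /z LE leq_addr.
have z_lt : (z < s1)%N.
  by rewrite /z /s1 LE ltn_add2l ltn_mod muln_gt0 k0.
have kz : (k %| z)%N.
  by move: kn; rewrite {1}nE dvdn_addr // -mulnA mulnCA dvdn_mulr.
clear large tn t0P.
have lnn : lam <= ln n%:R.
  rewrite -[lam]expRK ler_ln ?posrE ?expR_gt0 ?ltr0n //.
  apply: ltW (lt_le_trans (real_truncnS_gt _) _); first exact: num_real.
  by rewrite ler_nat.
have lam1 : 1 <= lam by rewrite /lam lerDl !mulr_ge0 ?invr_ge0 ?exprn_ge0 // ltW.
have bad s : (s0 <= s <= s1)%N -> (k %| s)%N -> bad_degree_le (matchable G) s.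
  move=> s_b ks; apply: (@property_graph_bad_degree R); last by rewrite cV; apply: hG.
  by case/andP: s_b => s0s _; apply: leq_trans s0s; apply: leq_trans hs0; rewrite muln_gt0.
have /andP[_ p1] := p01 n.
have p_ge := pm n mn kn.
pose q : R := D * n%:R ^- k.-1.
have nR : 0 < n%:R :> R by rewrite ltr0n.
have q0 : 0 < q by rewrite mulr_gt0 // invr_gt0 exprn_gt0.
have lnn1 : 1 <= ln n%:R :> R by apply: le_trans lnn.
have p_q : q * a * ln n%:R <= p n by move: p_ge; rewrite /q -!mulrA [a * _]mulrCA.
have u_le : u%:R <= ((ln 2)^-1 + 1) * ln n%:R :> R.
  rewrite /u -natr1 mulrDl mul1r lerD // ler_pdivlMl // mulrC.
  exact: trunc_log_le_ln.
have q8 : 8 * q <= 1.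
  (* That [q] is small follows from [p n <= 1], because [a > 8] and [ln n >= 1]. *)
  apply: le_trans (le_trans p_q p1).
  rewrite -mulrA [8 * q]mulrC ler_wpM2l ?(ltW q0) //.
  by apply: (@le_trans _ _ (a * 1)); [lra | rewrite ler_wpM2l //; lra].
have main := @Gp_prob_Mat_lower_bound R k V G N L z u j0 (u - j0) q (ln n%:R) (p n).
apply: le_trans (main _ _ _ _ _ _ _ _ _ _ _ _ _ _ _ _ _ _ _) => //.
- rewrite lerD2l lerN2.
  have h1 : 2 ^+ (2 ^ j0) / ln n%:R <= eps / 8 :> R.
    rewrite ler_pdivrMr; last by lra.
    rewrite mulrAC ler_pdivlMr // mulrC -ler_pdivrMl //.
    by apply: le_trans lnn; rewrite /lam; lra.
  have h2 : 2 ^- j0 <= eps / 8 :> R.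
    rewrite -[eps / 8]invrK lef_pV2 ?posrE ?exprn_gt0 ?invr_gt0 ?divr_gt0 //.
    by rewrite invf_div.
  lra.
- by rewrite cV.
- exact: leq_trans L_ge.
- by apply: leq_trans z_ge; apply: leq_trans ks_ge.
- by apply: bad; rewrite LE ?dvdn_mulr // leq_pmull // leq_addr.
- by apply: bad; rewrite ?dvdn_mulr // kL_s0 leq_addl.
- by apply: bad; rewrite // (ltnW z_lt) andbT; apply: leq_trans z_ge; rewrite leq_pmull.
- have h : (2 * k <= k * s0)%N by move: hk hs0; clear; nia.
  by rewrite LE -mulnn; apply: leq_trans (leq_mul ks_ge h); rewrite mulnA leq_mul2r orbT.
- by rewrite cV.
- by rewrite cV.
- by rewrite cV subnKC // ltnW.
- rewrite cV /q /D -!mulrA ler_wpM2l // !mulrA ler_wpM2r ?invr_ge0 ?exprn_ge0 //.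
  rewrite lerXn2r ?nnegrE ?mulr_ge0 ?expR_ge0 // ler_wpM2r ?expR_ge0 // ler_wpM2l //.
  by rewrite ler_nat leq_add2l ltnW.
- apply: le_trans p_q; rewrite /a.
  have : 8 * q * (u - j0)%:R <= 8 * q * (((ln 2)^-1 + 1) * ln n%:R).
    apply: ler_wpM2l; first by rewrite pmulr_rge0 // ltW.
    apply: le_trans u_le; by rewrite ler_nat leq_subr.
  lra.
Qed.
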